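(* Let $n>1$ be an integer. The set $\{N\in\mathcal{G}_n : \mathbb{F}_n/N \text{ has exponential growth}\}$ is $\mathbf{\Sigma}^0_2$-complete.
   Context: $\mathbb{F}_n$ is the free group on $\gamma_1,\dots,\gamma_n$. $\mathcal{G}_n$ denotes the set of normal subgroups $N\trianglelefteq\mathbb{F}_n$, viewed as a subset of $\{0,1\}^{\mathbb{F}_n}$ with the subspace topology of the product of discrete topologies; it is a compact zero-dimensional Polish space. For $N\in\mathcal{G}_n$, the growth function $\Gamma_N(x)$ ($x\in\mathbb{N}^+$) is the number of elements of $\mathbb{F}_n/N$ of word length at most $x$ with respect to the generators $\gamma_1N,\dots,\gamma_nN$. $\mathbb{F}_n/N$ has exponential growth if there is a real $a>1$ with $\Gamma_N(x)\ge a^x$ for all $x\in\mathbb{N}^+$. Borel classes: $\mathbf{\Sigma}^0_1$ = open sets, $\mathbf{\Pi}^0_\alpha$ = complements of $\mathbf{\Sigma}^0_\alpha$ sets, $\mathbf{\Sigma}^0_\alpha$ ($\alpha>1$) = countable unions of sets in $\bigcup_{\beta<\alpha}\mathbf{\Pi}^0_\beta$. For $\mathbf{\Gamma}$ one of these classes, $A\subseteq X$ is $\mathbf{\Gamma}$-complete if $A\in\mathbf{\Gamma}$ and for every zero-dimensional Polish space $Y$ and every $B\subseteq Y$ in $\mathbf{\Gamma}$ there is a continuous $f:Y\to X$ with $f^{-1}[A]=B$. *)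

(* Defs.v *)
From Stdlib Require Import Reals List Bool Arith.
Import ListNotations.
Set Implicit Arguments.

(* A letter (i, false) is gamma_i, (i, true) is gamma_i^{-1}. *)
Definition letter : Type := (nat * bool)%type.
Definition inv_letter (a : letter) : letter := (fst a, negb (snd a)).
Definition letter_eqb (a b : letter) : bool :=
  Nat.eqb (fst a) (fst b) && Bool.eqb (snd a) (snd b).
Definition is_inv (a b : letter) : bool := letter_eqb b (inv_letter a).

Fixpoint reduced (w : list letter) : bool :=
  match w with
  | a :: ((b :: _) as t) => negb (is_inv a b) && reduced t
  | _ => true
  end.
Definition bounded (n : nat) (w : list letter) : bool :=
  forallb (fun a => Nat.ltb (fst a) n) w.
Definition valid (n : nat) (w : list letter) : bool := bounded n w && reduced w.

Definition F (n : nat) : Type := {w : list letter | valid n w = true}.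

Definition push (a : letter) (w : list letter) : list letter :=
  match w with
  | [] => [a]
  | b :: t => if is_inv a b then t else a :: w
  end.

Lemma push_valid n a w :
  Nat.ltb (fst a) n = true -> valid n w = true -> valid n (push a w) = true.
Proof.
  intros Ha Hw. destruct w as [|b t]; simpl.
  - unfold valid; simpl; rewrite Ha; reflexivity.
  - unfold valid in *. simpl in Hw.
    apply andb_prop in Hw as [Hb Hr]. apply andb_prop in Hb as [Hb1 Hb2].
    destruct (is_inv a b) eqn:E.
    + apply andb_true_intro; split; [exact Hb2|].
      destruct t as [|c t']; [reflexivity|].
      apply andb_prop in Hr as [_ Hr]; exact Hr.
    + simpl. rewrite Ha, Hb1, Hb2, E. simpl. exact Hr.
Qed.

Lemma fold_push_valid n u v :
  bounded n u = true -> valid n v = true -> valid n (fold_right push v u) = true.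
Proof.
  induction u as [|a u IH]; intros Hu Hv; simpl; [exact Hv|].
  unfold bounded in Hu; simpl in Hu. apply andb_prop in Hu as [Ha Hu].
  apply push_valid; [exact Ha|]. apply IH; assumption.
Qed.

Lemma fold_inv_valid n u acc :
  bounded n u = true -> valid n acc = true ->
  valid n (fold_left (fun acc a => push (inv_letter a) acc) u acc) = true.
Proof.
  revert acc. induction u as [|a u IH]; intros acc Hu Hv; simpl; [exact Hv|].
  unfold bounded in Hu; simpl in Hu. apply andb_prop in Hu as [Ha Hu].
  apply IH; [exact Hu|]. apply push_valid; [exact Ha|exact Hv].
Qed.

Lemma valid_bounded n w : valid n w = true -> bounded n w = true.
Proof. unfold valid; intros H; apply andb_prop in H; tauto. Qed.

Definition one (n : nat) : F n := exist _ [] eq_refl.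

Definition mul (n : nat) (g h : F n) : F n :=
  exist _ (fold_right push (proj1_sig h) (proj1_sig g))
    (fold_push_valid n _ _ (valid_bounded n _ (proj2_sig g)) (proj2_sig h)).

Definition inv (n : nat) (g : F n) : F n :=
  exist _ (fold_left (fun acc a => push (inv_letter a) acc) (proj1_sig g) [])
    (fold_inv_valid n _ _ (valid_bounded n _ (proj2_sig g)) (eq_refl : valid n [] = true)).

Lemma single_valid n (a : letter) : Nat.ltb (fst a) n = true -> valid n [a] = true.
Proof. intros H; unfold valid, bounded; simpl; rewrite H; reflexivity. Qed.

(* the element of F_n denoted by a letter (letters out of range give 1) *)
Definition gen (n : nat) (a : letter) : F n :=
  (if Nat.ltb (fst a) n as b return (Nat.ltb (fst a) n = b -> F n)
   then fun H => exist _ [a] (single_valid n a H)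
   else fun _ => one n) eq_refl.

Definition evalF (n : nat) (w : list letter) : F n :=
  fold_right (fun a g => mul (gen n a) g) (one n) w.

Definition is_normal (n : nat) (N : F n -> bool) : Prop :=
  N (one n) = true /\
  (forall g h, N g = true -> N h = true -> N (mul g h) = true) /\
  (forall g, N g = true -> N (inv g) = true) /\
  (forall g h, N h = true -> N (mul (mul g h) (inv g)) = true).

Definition letters (n : nat) : list letter :=
  flat_map (fun i => [(i, false); (i, true)]) (seq 0 n).
Fixpoint words (n k : nat) : list (list letter) :=
  match k with
  | 0 => [[]]
  | S k' => flat_map (fun w => map (fun a => a :: w) (letters n)) (words n k')
  end.
Definition ball (n x : nat) : list (F n) :=
  map (evalF n) (flat_map (words n) (seq 0 (S x))).

Definition coset_reps (n : nat) (N : F n -> bool) (l : list (F n)) : list (F n) :=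
  fold_left (fun reps g =>
    if existsb (fun h => N (mul (inv h) g)) reps then reps else g :: reps) l [].

Definition Gamma (n : nat) (N : F n -> bool) (x : nat) : nat :=
  length (coset_reps N (ball n x)).

Definition exp_growth (n : nat) (N : F n -> bool) : Prop :=
  exists a : R, (1 < a)%R /\
    forall x : nat, (1 <= x)%nat -> (a ^ x <= INR (Gamma N x))%R.

Definition ExpGrowthSet (n : nat) (N : F n -> bool) : Prop :=
  is_normal N /\ exp_growth N.

Definition openX (n : nat) (U : (F n -> bool) -> Prop) : Prop :=
  forall x, U x -> exists l : list (F n),
    forall x', (forall g, In g l -> x' g = x g) -> U x'.
Definition closedX (n : nat) (C : (F n -> bool) -> Prop) : Prop :=
  openX (fun x => ~ C x).
(* Sigma^0_2 subsets of the subspace G_n: countable unions of closed sets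
   of G_n (closed sets of the subspace = traces of closed sets of X) *)
Definition Sigma02_Gn (n : nat) (A : (F n -> bool) -> Prop) : Prop :=
  exists C : nat -> (F n -> bool) -> Prop,
    (forall k, closedX (C k)) /\
    (forall x, A x <-> (is_normal x /\ exists k, C k x)).

Definition is_metric {Y : Type} (d : Y -> Y -> R) : Prop :=
  (forall x y, (0 <= d x y)%R) /\
  (forall x y, d x y = 0%R <-> x = y) /\
  (forall x y, d x y = d y x) /\
  (forall x y z, (d x z <= d x y + d y z)%R).
Definition mopen {Y : Type} (d : Y -> Y -> R) (U : Y -> Prop) : Prop :=
  forall y, U y -> exists eps, (0 < eps)%R /\ forall z, (d y z < eps)%R -> U z.
Definition mclosed {Y : Type} (d : Y -> Y -> R) (C : Y -> Prop) : Prop :=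
  mopen d (fun y => ~ C y).
Definition m_complete {Y : Type} (d : Y -> Y -> R) : Prop :=
  forall s : nat -> Y,
    (forall eps, (0 < eps)%R -> exists N, forall p q, (N <= p)%nat -> (N <= q)%nat ->
        (d (s p) (s q) < eps)%R) ->
    exists l, forall eps, (0 < eps)%R -> exists N, forall p, (N <= p)%nat ->
        (d (s p) l < eps)%R.
(* countable dense subset (possibly empty, via option) *)
Definition m_separable {Y : Type} (d : Y -> Y -> R) : Prop :=
  exists s : nat -> option Y, forall y eps, (0 < eps)%R ->
    exists k y', s k = Some y' /\ (d y y' < eps)%R.
Definition m_zero_dim {Y : Type} (d : Y -> Y -> R) : Prop :=
  forall U y, mopen d U -> U y ->
    exists V, mopen d V /\ mclosed d V /\ V y /\ forall z, V z -> U z.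
Definition Sigma02 {Y : Type} (d : Y -> Y -> R) (B : Y -> Prop) : Prop :=
  exists C : nat -> Y -> Prop,
    (forall k, mclosed d (C k)) /\ (forall y, B y <-> exists k, C k y).

Definition cont_into_Gn {Y : Type} (d : Y -> Y -> R) (n : nat)
    (f : Y -> (F n -> bool)) : Prop :=
  (forall y, is_normal (f y)) /\
  (forall U, openX U -> mopen d (fun y => U (f y))).

Definition Sigma02_complete_Gn (n : nat) (A : (F n -> bool) -> Prop) : Prop :=
  Sigma02_Gn A /\
  forall (Y : Type) (d : Y -> Y -> R),
    is_metric d -> m_complete d -> m_separable d -> m_zero_dim d ->
    forall B : Y -> Prop, Sigma02 d B ->
      exists f : Y -> (F n -> bool),
        cont_into_Gn d f /\ forall y, A (f y) <-> B y.

(* Main.v *)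
Require Import Defs.
From Stdlib Require Import Reals List Bool Arith.
From Stdlib Require Import Lia Lra Cantor.
From Stdlib Require Import ClassicalEpsilon FunctionalExtensionality PropExtensionality.
Import ListNotations.

(** The condition is Sigma^0_2 because Gamma_N(x) depends on finitely many
    coordinates of N, and a > 1 may be taken of the form 1 + 1/(k+1).

    For hardness, a point y of Y is first turned continuously into a sequence
    omega in {0,1}^nat that is eventually 0 exactly when y lies in B. Then omega
    is sent to a group of Grigorchuk type: generators a, b, c, d, where a has
    order 2 and b, c, d generate a Klein four-group, and where an element is
    trivial iff it contains an even number of a's and its two coordinates are
    trivial in the group of the shifted sequence. If omega_0 = 1 the coordinates
    are b = (a,c), c = (a,d), d = (1,b); then a weighted word length contracts by
    5/6, so every occurrence of 1 raises the growth rate to the power 5/6 and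
    infinitely many of them exclude exponential growth. If omega_0 = 0 the
    coordinates are b = (a,b), c = (a,c), d = (1,d); the group of the zero sequence
    contains a lamplighter-like family of 2^k elements of length at most 3k, and
    exponential growth lifts through finitely many further steps. Whether a word
    is trivial depends only on a finite part of omega, which gives continuity. A
    subgroup of a wreath product with Z/4 reduces four generators to two. *)

(** * Words over a, b, c, d and normal forms in C_2 * V_4 *)

Inductive gletter : Type := La | Lb | Lc | Ld.
Definition gword : Type := list gletter.

Definition gletter_eq_dec (x y : gletter) : {x = y} + {x <> y}.
Proof. decide equality. Defined.

Definition is_a (x : gletter) : bool := match x with La => true | _ => false end.

Fixpoint alternating (w : gword) : bool :=
  match w with
  | x :: ((y :: _) as t) => xorb (is_a x) (is_a y) && alternating t
  | _ => true
  end.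

Definition gpush (x : gletter) (w : gword) : gword :=
  match w with
  | [] => [x]
  | y :: t =>
      match x, y with
      | La, La | Lb, Lb | Lc, Lc | Ld, Ld => t
      | Lb, Lc | Lc, Lb => Ld :: t
      | Lb, Ld | Ld, Lb => Lc :: t
      | Lc, Ld | Ld, Lc => Lb :: t
      | _, _ => x :: w
      end
  end.

(** Van der Waerden's trick: C_2 * V_4 acts from the left on alternating words, and [norm] reads off
    the normal form as the image of the empty word. *)
Definition gact (w n : gword) : gword := fold_right gpush n w.
Definition norm (w : gword) : gword := gact w [].

Lemma alternating_tail x w : alternating (x :: w) = true -> alternating w = true.
Proof.
  destruct w as [|y w]; [reflexivity|].
  intros H; apply andb_prop in H as [_ H]; exact H.
Qed.

Ltac alt_cases n :=
  let y := fresh "y" in let t := fresh "t" in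
  let z := fresh "z" in let t' := fresh "t" in
  destruct n as [|y [|z t']]; [| destruct y | destruct y; destruct z].

Lemma alternating_gpush x n : alternating n = true -> alternating (gpush x n) = true.
Proof.
  destruct x; alt_cases n; cbn; intros H; try discriminate H; try reflexivity; exact H.
Qed.

Lemma gpush_gpush x n : alternating n = true -> gpush x (gpush x n) = n.
Proof.
  destruct x; alt_cases n; cbn; intros H; try discriminate H; reflexivity.
Qed.

(** The equation [gpush x (y :: t) = z :: t] encodes that z is the product of x and y in the Klein
    group; comparing lengths, it excludes x = y. *)
Lemma gpush_klein x y z t n : x <> La -> y <> La -> gpush x (y :: t) = z :: t ->
  alternating n = true -> gpush x (gpush y n) = gpush z n.
Proof.
  intros Hx Hy E. destruct x; try congruence; destruct y; try congruence;
    cbn in E; try (apply (f_equal (@length _)) in E; cbn in E; lia);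
    injection E as <-; alt_cases n; cbn; intros H; try discriminate H; reflexivity.
Qed.

Lemma alternating_gact w n : alternating n = true -> alternating (gact w n) = true.
Proof.
  intros H; induction w as [|x w IH]; [exact H|]. cbn; apply alternating_gpush, IH.
Qed.

Lemma alternating_norm w : alternating (norm w) = true.
Proof. apply alternating_gact; reflexivity. Qed.

Lemma gact_app u v n : gact (u ++ v) n = gact u (gact v n).
Proof. apply fold_right_app. Qed.

Lemma gact_gpush x m n : alternating n = true -> gact (gpush x m) n = gpush x (gact m n).
Proof.
  intros H. destruct m as [|y t]; [reflexivity|].
  assert (Ht := alternating_gact t n H).
  destruct x, y; cbn [gpush gact fold_right]; fold (gact t n);
    try reflexivity; try (symmetry; apply gpush_gpush; exact Ht);
    symmetry; apply gpush_klein with (t := []); (discriminate || reflexivity || exact Ht).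
Qed.

Lemma gact_norm w n : alternating n = true -> gact (norm w) n = gact w n.
Proof.
  intros H; induction w as [|x w IH]; [reflexivity|].
  change (norm (x :: w)) with (gpush x (norm w)).
  rewrite gact_gpush by exact H. rewrite IH. reflexivity.
Qed.

Lemma gact_rev_gact u n : alternating n = true -> gact (rev u) (gact u n) = n.
Proof.
  intros H; induction u as [|x u IH]; [reflexivity|].
  cbn [rev]. rewrite gact_app. cbn [gact fold_right]. fold (gact u n).
  rewrite gpush_gpush by (apply alternating_gact, H). exact IH.
Qed.

Lemma norm_alternating n : alternating n = true -> norm n = n.
Proof.
  induction n as [|x n IH]; intros H; [reflexivity|].
  change (norm (x :: n)) with (gpush x (norm n)).
  rewrite IH by (apply alternating_tail in H; exact H).
  destruct n as [|y n]; [reflexivity|].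
  destruct x, y; cbn in H; try discriminate H; reflexivity.
Qed.

Lemma norm_app u v : norm (u ++ v) = gact u (norm v).
Proof. apply gact_app. Qed.

Lemma norm_app_congr u u' v v' :
  norm u = norm u' -> norm v = norm v' -> norm (u ++ v) = norm (u' ++ v').
Proof.
  intros Hu Hv. rewrite !norm_app, Hv.
  rewrite <- (gact_norm u), <- (gact_norm u'), Hu by apply alternating_norm.
  reflexivity.
Qed.

(** Every generator is an involution, so reversal is inversion. *)
Lemma norm_rev_app u : norm (rev u ++ u) = [].
Proof. rewrite norm_app. apply gact_rev_gact; reflexivity. Qed.

Lemma norm_app_rev u : norm (u ++ rev u) = [].
Proof. rewrite <- (rev_involutive u) at 1. apply norm_rev_app. Qed.

Lemma norm_rev_congr u v : norm u = norm v -> norm (rev u) = norm (rev v).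
Proof.
  intros H.
  transitivity (norm (rev u ++ (v ++ rev v))).
  { rewrite <- (app_nil_r (rev u)) at 1. apply norm_app_congr; [reflexivity|].
    symmetry; apply norm_app_rev. }
  rewrite app_assoc.
  change (rev v) with ([] ++ rev v) at 2. apply norm_app_congr; [|reflexivity].
  transitivity (norm (rev u ++ u)); [|apply norm_rev_app].
  apply norm_app_congr; auto.
Qed.

Lemma norm_norm w : norm (norm w) = norm w.
Proof. apply norm_alternating, alternating_norm. Qed.

(** * Normal subgroups containing the relations of C_2 * V_4 *)

Record normal_set (K : gword -> bool) : Prop := {
  ns_nil : K [] = true;
  ns_norm : forall u v, norm u = norm v -> K u = K v;
  ns_app : forall u v, K u = true -> K v = true -> K (u ++ v) = true;
  ns_conj : forall u v, K u = true -> K (v ++ u ++ rev v) = true;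
  ns_rev : forall u, K u = true -> K (rev u) = true }.
Arguments ns_nil {K}.
Arguments ns_norm {K}.
Arguments ns_app {K}.
Arguments ns_conj {K}.
Arguments ns_rev {K}.

(** Equality in the quotient by [K], with [rev u] as the inverse of u. *)
Definition geq (K : gword -> bool) (u v : gword) : Prop := K (rev u ++ v) = true.

Section NormalSet.
Context (K : gword -> bool) (HK : normal_set K).

Lemma geq_norm u v : norm u = norm v -> geq K u v.
Proof.
  intros H. unfold geq. rewrite <- (ns_nil HK). apply (ns_norm HK).
  change (norm []) with (@nil gletter). rewrite <- (norm_rev_app v).
  apply norm_app_congr; [apply norm_rev_congr, H|reflexivity].
Qed.

Lemma geq_refl u : geq K u u.
Proof. apply geq_norm; reflexivity. Qed.

Lemma geq_sym u v : geq K u v -> geq K v u.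
Proof.
  unfold geq; intros H. apply (ns_rev HK) in H.
  rewrite rev_app_distr, rev_involutive in H. exact H.
Qed.

Lemma geq_trans u v w : geq K u v -> geq K v w -> geq K u w.
Proof.
  unfold geq; intros H1 H2. rewrite <- (ns_app HK _ _ H1 H2). apply (ns_norm HK).
  rewrite <- app_assoc. apply norm_app_congr; [reflexivity|].
  rewrite app_assoc. change w with ([] ++ w) at 1.
  apply norm_app_congr; [|reflexivity]. symmetry; apply norm_app_rev.
Qed.

(** Normality enters here: (uv)^-1 u'v' is the conjugate of u^-1 u' by v^-1, times v^-1 v'. *)
Lemma geq_app u u' v v' : geq K u u' -> geq K v v' -> geq K (u ++ v) (u' ++ v').
Proof.
  unfold geq; intros H1 H2.
  apply (fun h => ns_conj HK _ (rev v) h) in H1. rewrite rev_involutive in H1.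
  rewrite <- (ns_app HK _ _ H1 H2). apply (ns_norm HK).
  rewrite rev_app_distr, <- !app_assoc.
  do 3 (apply norm_app_congr; [reflexivity|]).
  rewrite app_assoc. change v' with ([] ++ v') at 1.
  apply norm_app_congr; [|reflexivity]. symmetry; apply norm_app_rev.
Qed.

End NormalSet.

Definition trivial_word (w : gword) : bool := match norm w with [] => true | _ => false end.

Lemma trivial_wordP w : trivial_word w = true <-> norm w = [].
Proof. unfold trivial_word; destruct (norm w); split; congruence. Qed.

Lemma normal_set_trivial_word : normal_set trivial_word.
Proof.
  split.
  - reflexivity.
  - intros u v H; unfold trivial_word; rewrite H; reflexivity.
  - intros u v; rewrite !trivial_wordP; intros Hu Hv.
    apply (norm_app_congr u [] v []); assumption.
  - intros u v; rewrite !trivial_wordP; intros Hu.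
    rewrite <- (norm_app_rev v). apply norm_app_congr; [reflexivity|].
    apply (norm_app_congr u [] (rev v) (rev v)); auto.
  - intros u; rewrite !trivial_wordP; intros Hu. apply (norm_rev_congr u []), Hu.
Qed.

(** * Self-similar steps *)

(* For [o = true] the coordinates are b = (a,c), c = (a,d), d = (1,b); for
   [o = false] they are b = (a,b), c = (a,c), d = (1,d). In both cases the letter
   a swaps the coordinates, which are indexed by [false] and [true]. *)
Definition coord_letter (o i : bool) (x : gletter) : gword :=
  match x, i with
  | La, _ => []
  | Ld, false => []
  | _, false => [La]
  | Lb, true => if o then [Lc] else [Lb]
  | Lc, true => if o then [Ld] else [Lc]
  | Ld, true => if o then [Lb] else [Ld]
  end.

Fixpoint coord (o i : bool) (w : gword) : gword :=
  match w with
  | [] => []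
  | x :: t => coord_letter o i x ++ coord o (xorb i (is_a x)) t
  end.

Definition parity (w : gword) : bool := fold_right (fun x p => xorb (is_a x) p) false w.

(** For normal [K], this is the kernel of the map to the wreath product of the quotient by [K] with
    C_2. *)
Definition step (o : bool) (K : gword -> bool) (w : gword) : bool :=
  negb (parity w) && (K (coord o false w) && K (coord o true w)).

Lemma stepP o K w :
  step o K w = true <-> parity w = false /\ forall i, K (coord o i w) = true.
Proof.
  unfold step. split.
  - intros H. apply andb_prop in H as [H1 H]. apply andb_prop in H as [H2 H3].
    split; [destruct (parity w); auto|]. intros []; assumption.
  - intros [H1 H2]. rewrite H1, !H2. reflexivity.
Qed.

Lemma parity_app u v : parity (u ++ v) = xorb (parity u) (parity v).
Proof.
  induction u as [|x u IH]; cbn; [reflexivity|].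
  unfold parity in *. rewrite IH, xorb_assoc. reflexivity.
Qed.

Lemma parity_cons x w : parity (x :: w) = xorb (is_a x) (parity w).
Proof. reflexivity. Qed.

Lemma parity_rev u : parity (rev u) = parity u.
Proof.
  induction u as [|x u IH]; [reflexivity|].
  cbn [rev]. rewrite parity_app, IH. cbn. rewrite xorb_false_r. apply xorb_comm.
Qed.

Lemma coord_app o i u v : coord o i (u ++ v) = coord o i u ++ coord o (xorb i (parity u)) v.
Proof.
  revert i; induction u as [|x u IH]; intros i; cbn [coord app].
  - cbn. rewrite xorb_false_r. reflexivity.
  - rewrite IH, <- app_assoc, parity_cons, xorb_assoc. reflexivity.
Qed.

(** Inversion in the wreath product: reading the reversed word from index i retraces the reading of
    u that ends at i. *)
Lemma coord_rev o i u : coord o i (rev u) = rev (coord o (xorb i (parity u)) u).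
Proof.
  revert i; induction u as [|x u IH]; intros i; [reflexivity|].
  cbn [rev coord]. rewrite coord_app, IH, rev_app_distr, parity_rev, parity_cons.
  cbn [coord]. rewrite app_nil_r.
  f_equal.
  - do 2 f_equal. destruct i, (is_a x), (parity u); reflexivity.
  - destruct x; cbn [is_a]; rewrite ?xorb_false_l; destruct i, (parity u), o; reflexivity.
Qed.

Lemma coord_rev_app o i u v :
  coord o i (rev u ++ v) =
  rev (coord o (xorb i (parity u)) u) ++ coord o (xorb i (parity u)) v.
Proof. rewrite coord_app, coord_rev, parity_rev. reflexivity. Qed.

Lemma norm_cons_cons x y w : norm (x :: y :: w) = gpush x (gpush y (norm w)).
Proof. reflexivity. Qed.

Lemma norm_cancel x w : norm (x :: x :: w) = norm w.
Proof. rewrite norm_cons_cons. apply gpush_gpush, alternating_norm. Qed.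

Lemma norm_klein x y z w : x <> La -> y <> La -> gpush x [y] = [z] ->
  norm (x :: y :: w) = norm (z :: w).
Proof.
  intros Hx Hy E. rewrite norm_cons_cons.
  apply gpush_klein with (t := []); auto using alternating_norm.
Qed.

(** The coordinates respect the relations: at [false] the letters b, c, d become a, a, 1, at [true]
    they are permuted, and two letters a restore the index. *)
Lemma coord_gpush o i x n :
  norm (coord o i (gpush x n)) = norm (coord o i (x :: n)).
Proof.
  destruct n as [|y t]; [reflexivity|].
  destruct x, y; try reflexivity; destruct o, i; cbn -[norm];
    try reflexivity; try (symmetry; apply norm_cancel);
    symmetry; apply norm_klein; (discriminate || reflexivity).
Qed.

Lemma parity_gpush x n : parity (gpush x n) = parity (x :: n).
Proof.
  destruct n as [|y t]; [reflexivity|].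
  destruct x, y; cbn; try reflexivity; fold (parity t);
   destruct (parity t); reflexivity.
Qed.

Lemma coord_norm o i w : norm (coord o i (norm w)) = norm (coord o i w).
Proof.
  revert i; induction w as [|x w IH]; intros i; [reflexivity|].
  change (norm (x :: w)) with (gpush x (norm w)). rewrite coord_gpush.
  cbn [coord]. apply norm_app_congr; auto.
Qed.

Lemma parity_norm w : parity (norm w) = parity w.
Proof.
  induction w as [|x w IH]; [reflexivity|].
  change (norm (x :: w)) with (gpush x (norm w)). rewrite parity_gpush.
  rewrite !parity_cons, IH. reflexivity.
Qed.

Lemma normal_set_step o K : normal_set K -> normal_set (step o K).
Proof.
  intros HK. split.
  - apply stepP. split; [reflexivity|]. intros i; apply (ns_nil HK).
  - intros u v H.
    assert (E : forall i, K (coord o i u) = K (coord o i v)).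
    { intros i. apply (ns_norm HK). rewrite <- (coord_norm o i u), H. apply coord_norm. }
    unfold step. rewrite !E, <- (parity_norm u), H, parity_norm. reflexivity.
  - intros u v; rewrite !stepP; intros [Pu Hu] [Pv Hv]. split.
    + rewrite parity_app, Pu, Pv; reflexivity.
    + intros i. rewrite coord_app. apply (ns_app HK); auto.
  - intros u v; rewrite !stepP; intros [Pu Hu]. split.
    + rewrite !parity_app, parity_rev, Pu. destruct (parity v); reflexivity.
    + intros i. rewrite !coord_app, coord_rev, Pu.
      replace (xorb (xorb (xorb i (parity v)) false) (parity v)) with i
        by (destruct i, (parity v); reflexivity).
      apply (ns_conj HK), Hu.
  - intros u; rewrite !stepP; intros [Pu Hu]. split.
    + rewrite parity_rev; exact Pu.
    + intros i. rewrite coord_rev. apply (ns_rev HK), Hu.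
Qed.

Lemma geq_step o K u v :
  geq (step o K) u v <-> parity u = parity v /\ forall i, geq K (coord o i u) (coord o i v).
Proof.
  unfold geq. rewrite stepP, parity_app, parity_rev. split; intros [P H].
  - apply xorb_eq in P. split; [exact P|]. intros i.
    specialize (H (xorb i (parity u))). rewrite coord_rev_app in H.
    replace (xorb (xorb i (parity u)) (parity u)) with i in H
      by (destruct i, (parity u); reflexivity).
    exact H.
  - rewrite P, xorb_nilpotent. split; [reflexivity|]. intros i.
    rewrite coord_rev_app. apply H.
Qed.

(** * The limit of infinitely many steps *)

Fixpoint iter_steps (k : nat) (om : nat -> bool) : gword -> bool :=
  match k with
  | 0 => trivial_word
  | S k' => step (om 0%nat) (iter_steps k' (fun j => om (S j)))
  end.

(* [length w] steps decide [w]: words shrink by half at each step. *)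
Definition limit_set (om : nat -> bool) (w : gword) : bool := iter_steps (length w) om w.

Lemma normal_set_iter k om : normal_set (iter_steps k om).
Proof.
  revert om; induction k as [|k IH]; intros om; cbn.
  - apply normal_set_trivial_word.
  - apply normal_set_step, IH.
Qed.

Lemma length_gpush x n : (length (gpush x n) <= S (length n))%nat.
Proof. destruct n as [|y t]; [cbn; lia|]. destruct x, y; cbn; lia. Qed.

Lemma length_norm w : (length (norm w) <= length w)%nat.
Proof.
  induction w as [|x w IH]; [cbn; lia|].
  change (norm (x :: w)) with (gpush x (norm w)).
  pose proof (length_gpush x (norm w)). cbn [length]. lia.
Qed.

Definition count_a (w : gword) : nat := length (filter is_a w).
Definition count_other (w : gword) : nat := length (filter (fun x => negb (is_a x)) w).

Lemma count_a_other w : (count_a w + count_other w = length w)%nat.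
Proof. unfold count_a, count_other. apply filter_length. Qed.

(** The second clause carries the induction: a letter other than a can only be put in front of a
    word that is empty or begins with a. *)
Lemma alternating_count w : alternating w = true ->
  (count_other w <= S (count_a w))%nat /\
  (hd Lb w = La -> count_other w <= count_a w)%nat.
Proof.
  induction w as [|x w IH]; intros H; [cbn; lia|].
  pose proof (IH (alternating_tail _ _ H)) as [H1 H2].
  destruct w as [|y w].
  - destruct x; cbn; split; try lia; discriminate.
  - unfold count_a, count_other in *.
    destruct x, y; cbn [alternating is_a xorb andb] in H; try discriminate H;
      cbn [filter is_a negb length hd] in *; split; intros; try discriminate; try lia;
      specialize (H2 eq_refl); lia.
Qed.

Lemma length_coord o i w : (length (coord o i w) <= count_other w)%nat.
Proof.
  unfold count_other.
  revert i; induction w as [|x w IH]; intros i; [cbn; lia|].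
  cbn [coord filter]. rewrite length_app. specialize (IH (xorb i (is_a x))).
  destruct x, i, o; cbn in *; lia.
Qed.

(** Induction by halving. A nonempty normal form of length at most 2 is still detected after one
    step, by its parity or by a coordinate of length 1; this is the case k = 0. *)
Lemma iter_steps_S k om w : (length (norm w) <= 2 ^ k + 1)%nat ->
  iter_steps k om w = iter_steps (S k) om w.
Proof.
  revert om w; induction k as [|k IH]; intros om w H.
  - rewrite (ns_norm (normal_set_iter 0 om) w (norm w)) by (rewrite norm_norm; reflexivity).
    rewrite (ns_norm (normal_set_iter 1 om) w (norm w)) by (rewrite norm_norm; reflexivity).
    pose proof (alternating_norm w) as Ha. cbn [iter_steps]. cbn in H.
    generalize (om 0%nat); intros o.
    destruct (norm w) as [|x [|y [|z t]]]; cbn in H; [| | |lia].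
    + destruct o; reflexivity.
    + destruct x, o; reflexivity.
    + destruct x, y; cbn in Ha; try discriminate Ha; destruct o; reflexivity.
  - rewrite (ns_norm (normal_set_iter (S k) om) w (norm w)) by (rewrite norm_norm; reflexivity).
    rewrite (ns_norm (normal_set_iter (S (S k)) om) w (norm w)) by (rewrite norm_norm; reflexivity).
    pose proof (alternating_norm w) as Ha.
    change (iter_steps (S (S k)) om (norm w)) with
      (step (om 0%nat) (iter_steps (S k) (fun j => om (S j))) (norm w)).
    change (iter_steps (S k) om (norm w)) with
      (step (om 0%nat) (iter_steps k (fun j => om (S j))) (norm w)).
    (* A coordinate has at most one letter for each letter other than a, and a normal form of length
       at most 2 ^ (k + 1) + 1 has at most 2 ^ k + 1 of those. *)
    assert (E : forall i, (length (norm (coord (om 0%nat) i (norm w))) <= 2 ^ k + 1)%nat).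
    { intros i.
      pose proof (length_norm (coord (om 0%nat) i (norm w))).
      pose proof (length_coord (om 0%nat) i (norm w)).
      pose proof (count_a_other (norm w)).
      pose proof (proj1 (alternating_count _ Ha)).
      cbn [Nat.pow] in H. lia. }
    unfold step. rewrite !IH by apply E. reflexivity.
Qed.

Lemma length_le_pow2 k : (k <= 2 ^ k + 1)%nat.
Proof. pose proof (Nat.pow_gt_lin_r 2 k). lia. Qed.

Lemma iter_steps_limit k om w : (length w <= k)%nat -> iter_steps k om w = limit_set om w.
Proof.
  intros H. unfold limit_set. induction H as [|k H IH]; [reflexivity|].
  rewrite <- iter_steps_S; [exact IH|].
  pose proof (length_norm w). pose proof (length_le_pow2 k). lia.
Qed.

Lemma length_coord_le o i w : (length (coord o i w) <= length w)%nat.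
Proof.
  pose proof (length_coord o i w). pose proof (count_a_other w). lia.
Qed.

Lemma limit_set_step om w :
  limit_set om w = step (om 0%nat) (limit_set (fun j => om (S j))) w.
Proof.
  rewrite <- (iter_steps_limit (S (length w))) by lia. cbn [iter_steps].
  unfold step. rewrite !iter_steps_limit by apply length_coord_le. reflexivity.
Qed.

Lemma limit_set_step_ext om :
  limit_set om = step (om 0%nat) (limit_set (fun j => om (S j))).
Proof. apply functional_extensionality, limit_set_step. Qed.

(** Each law involves finitely many words, so it can be checked at a single level that is at least
    as large as all their lengths. *)
Lemma normal_set_limit om : normal_set (limit_set om).
Proof.
  split.
  - reflexivity.
  - intros u v H.
    rewrite <- (iter_steps_limit (max (length u) (length v)) om u) by lia.
    rewrite <- (iter_steps_limit (max (length u) (length v)) om v) by lia.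
    apply (ns_norm (normal_set_iter _ _)), H.
  - intros u v.
    rewrite <- (iter_steps_limit (length (u ++ v)) om u) by (rewrite length_app; lia).
    rewrite <- (iter_steps_limit (length (u ++ v)) om v) by (rewrite length_app; lia).
    apply (ns_app (normal_set_iter _ _)).
  - intros u v.
    rewrite <- (iter_steps_limit (length (v ++ u ++ rev v)) om u)
      by (rewrite !length_app; lia).
    apply (ns_conj (normal_set_iter _ _)).
  - intros u. unfold limit_set. rewrite length_rev.
    apply (ns_rev (normal_set_iter _ _)).
Qed.

Lemma iter_steps_local k om om' w :
  (forall j, (j < k)%nat -> om j = om' j) -> iter_steps k om w = iter_steps k om' w.
Proof.
  revert om om' w; induction k as [|k IH]; intros om om' w H; [reflexivity|].
  cbn [iter_steps]. unfold step. rewrite (H 0%nat) by lia.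
  rewrite !(IH (fun j => om (S j)) (fun j => om' (S j))); [reflexivity| |];
    intros j Hj; apply H; lia.
Qed.

Lemma limit_set_local om om' w :
  (forall j, (j < length w)%nat -> om j = om' j) -> limit_set om w = limit_set om' w.
Proof. apply iter_steps_local. Qed.

(** * Weighted lengths *)

(* These weights make the step with coordinates b = (a,c), c = (a,d), d = (1,b)
   contract by 5/6: 16 + 14 <= 5/6 (16 + 20), 16 + 9 <= 5/6 (16 + 14),
   20 <= 5/6 (16 + 9). *)
Definition letter_weight (x : gletter) : nat :=
  match x with La => 16 | Lb => 20 | Lc => 14 | Ld => 9 end.

Definition weight (w : gword) : nat := list_sum (map letter_weight w).

Lemma weight_cons x w : weight (x :: w) = (letter_weight x + weight w)%nat.
Proof. reflexivity. Qed.

Lemma weight_app u v : weight (u ++ v) = (weight u + weight v)%nat.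
Proof. unfold weight. rewrite map_app. apply list_sum_app. Qed.

Lemma weight_le_length w : (weight w <= 20 * length w)%nat.
Proof.
  induction w as [|x w IH]; [cbn; lia|].
  rewrite weight_cons. destruct x; cbn [letter_weight length]; lia.
Qed.

(** Merging two Klein letters costs nothing because each of 20, 14, 9 is at most the sum of the
    other two. *)
Lemma weight_gpush x n : (weight (gpush x n) <= letter_weight x + weight n)%nat.
Proof.
  destruct n as [|y t]; [cbn; lia|].
  destruct x, y; cbn [gpush]; rewrite !weight_cons; cbn [letter_weight]; lia.
Qed.

Lemma weight_norm w : (weight (norm w) <= weight w)%nat.
Proof.
  induction w as [|x w IH]; [cbn; lia|].
  change (norm (x :: w)) with (gpush x (norm w)).
  pose proof (weight_gpush x (norm w)). rewrite weight_cons. lia.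
Qed.

Definition other_weight (w : gword) : nat := weight (filter (fun x => negb (is_a x)) w).

Lemma weight_split w : weight w = (16 * count_a w + other_weight w)%nat.
Proof.
  unfold other_weight, count_a.
  induction w as [|x w IH]; [reflexivity|].
  rewrite weight_cons, IH.
  destruct x; cbn [is_a filter negb length]; rewrite ?weight_cons; cbn [letter_weight]; lia.
Qed.

(** Letter by letter: a letter other than a contributes to the two coordinates together at most its
    own weight plus 16, or 5/6 of this in the contracting step. *)
Lemma weight_coords_le w :
  (weight (coord false false w) + weight (coord false true w)
   <= 16 * count_other w + other_weight w)%nat /\
  (6 * (weight (coord true false w) + weight (coord true true w))
   <= 5 * (16 * count_other w + other_weight w))%nat.
Proof.
  unfold other_weight, count_other.
  induction w as [|x w IH]; [cbn; lia|].
  cbn [coord]. rewrite !weight_app.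
  destruct x; cbn [is_a xorb filter negb coord_letter]; rewrite ?weight_cons;
    cbn [length letter_weight weight map list_sum fold_right]; lia.
Qed.

(** In an alternating word the 16 charged to each letter other than a is paid by an a, with at most
    one exception; this exception is the summand 16. *)
Lemma weight_coords o w : alternating w = true ->
  (6 * (weight (coord o false w) + weight (coord o true w))
   <= (if o then 5 else 6) * (weight w + 16))%nat.
Proof.
  intros H. pose proof (proj1 (alternating_count w H)).
  pose proof (weight_coords_le w). rewrite (weight_split w).
  destruct o; lia.
Qed.

(** * Growth series over canonical representatives *)

(** Representatives have to be alternating so that [weight_coords] applies to them. *)
Definition shortest (K : gword -> bool) (u r : gword) : Prop :=
  alternating r = true /\ geq K u r /\
  forall r', alternating r' = true -> geq K u r' -> (weight r <= weight r')%nat.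

Definition canon (K : gword -> bool) (u : gword) : gword :=
  epsilon (inhabits []) (shortest K u).

Lemma shortest_ex K u : normal_set K -> exists r, shortest K u r.
Proof.
  intros HK.
  assert (H : forall m r, (weight r <= m)%nat -> alternating r = true -> geq K u r ->
    exists r', shortest K u r').
  { induction m as [m IH] using lt_wf_ind; intros r Hm Ha He.
    destruct (classic (exists r', alternating r' = true /\ geq K u r' /\
      (weight r' < weight r)%nat)) as [[r' [H1 [H2 H3]]]|Hn].
    - apply (IH (weight r')) with r'; auto; lia.
    - exists r. split; [exact Ha|]. split; [exact He|]. intros r' H1 H2.
      destruct (le_lt_dec (weight r) (weight r')); [assumption|].
      exfalso; apply Hn; exists r'; auto. }
  apply (H (weight (norm u)) (norm u)); auto using alternating_norm.
  apply geq_norm; [exact HK|]. rewrite norm_norm; reflexivity.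
Qed.

Section Canon.
Context (K : gword -> bool) (HK : normal_set K).

Lemma canon_spec u : shortest K u (canon K u).
Proof. unfold canon. apply epsilon_spec, shortest_ex, HK. Qed.

Lemma canon_geq u : geq K u (canon K u).
Proof. apply canon_spec. Qed.

Lemma canon_alternating u : alternating (canon K u) = true.
Proof. apply canon_spec. Qed.

(** For congruent words the predicates [shortest K u] and [shortest K v] are equal by
    extensionality, and [epsilon] chooses the same witness for equal predicates. *)
Lemma canon_eq u v : canon K u = canon K v <-> geq K u v.
Proof.
  split; intros H.
  - apply (geq_trans K HK) with (canon K u); [apply canon_geq|].
    rewrite H. apply (geq_sym K HK), canon_geq.
  - unfold canon. f_equal. apply functional_extensionality; intros r.
    apply propositional_extensionality.
    assert (E : forall r, geq K u r <-> geq K v r).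
    { intros r'; split; intros H'; eapply (geq_trans K HK); eauto using geq_sym. }
    unfold shortest. rewrite E. split; intros [H1 [H2 H3]]; repeat split; auto;
      intros r' Ha Hr; apply H3; auto; apply E; exact Hr.
Qed.

Lemma weight_canon u : (weight (canon K u) <= weight u)%nat.
Proof.
  destruct (canon_spec u) as [_ [_ H]].
  etransitivity; [|apply weight_norm]. apply H; [apply alternating_norm|].
  apply geq_norm; [exact HK|]. rewrite norm_norm; reflexivity.
Qed.

Lemma canon_canon u : canon K (canon K u) = canon K u.
Proof. apply canon_eq. apply (geq_sym K HK), canon_geq. Qed.

End Canon.

Local Open Scope R_scope.

(** * Finite sums of reals over lists *)

Definition Rsum {T : Type} (h : T -> R) (l : list T) : R :=
  fold_right (fun x r => h x + r) 0 l.

Lemma Rsum_cons {T} (h : T -> R) x l : Rsum h (x :: l) = h x + Rsum h l.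
Proof. reflexivity. Qed.

Lemma Rsum_app {T} (h : T -> R) l1 l2 : Rsum h (l1 ++ l2) = Rsum h l1 + Rsum h l2.
Proof.
  induction l1 as [|x l IH]; cbn [app]; [cbn; lra|]. rewrite !Rsum_cons, IH; lra.
Qed.

Lemma Rsum_map {T U} (h : U -> R) (f : T -> U) l :
  Rsum h (map f l) = Rsum (fun x => h (f x)) l.
Proof.
  induction l as [|x l IH]; [reflexivity|]. cbn [map]. rewrite !Rsum_cons, IH; reflexivity.
Qed.

Lemma Rsum_scal {T} (h : T -> R) c l : Rsum (fun x => c * h x) l = c * Rsum h l.
Proof.
  induction l as [|x l IH]; [cbn; lra|]. rewrite !Rsum_cons, IH; lra.
Qed.

Lemma Rsum_le {T} (h k : T -> R) l : (forall x, In x l -> h x <= k x) -> Rsum h l <= Rsum k l.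
Proof.
  induction l as [|x l IH]; intros H; [cbn; lra|]. rewrite !Rsum_cons.
  apply Rplus_le_compat; [apply H; left; reflexivity|apply IH; intros; apply H; right; auto].
Qed.

Lemma Rsum_ge0 {T} (h : T -> R) l : (forall x, 0 <= h x) -> 0 <= Rsum h l.
Proof.
  intros H; induction l as [|x l IH]; [cbn; lra|]. rewrite Rsum_cons. specialize (H x); lra.
Qed.

Lemma Rsum_incl {T} (h : T -> R) l l' : (forall x, 0 <= h x) ->
  NoDup l -> incl l l' -> Rsum h l <= Rsum h l'.
Proof.
  intros Hp Hl; revert l'; induction Hl as [|x l Hx Hl IH]; intros l' Hi.
  - apply Rsum_ge0, Hp.
  - destruct (in_split x l' (Hi x (or_introl eq_refl))) as [l1 [l2 ->]].
    assert (E : Rsum h (l1 ++ x :: l2) = h x + Rsum h (l1 ++ l2)).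
    { rewrite !Rsum_app, Rsum_cons; lra. }
    rewrite E. cbn. apply Rplus_le_compat_l, IH.
    intros y Hy. assert (Hy' := Hi y (or_intror Hy)).
    apply in_app_iff in Hy' as [Hy'|[->|Hy']]; [|contradiction|];
      apply in_app_iff; auto.
Qed.

Lemma Rsum_list_prod {T U} (h : T -> R) (k : U -> R) l m :
  Rsum (fun p => h (fst p) * k (snd p)) (list_prod l m) = Rsum h l * Rsum k m.
Proof.
  induction l as [|x l IH]; cbn [list_prod].
  - cbn; lra.
  - rewrite Rsum_app, IH, Rsum_map. cbn [fst snd].
    rewrite Rsum_scal, Rsum_cons; lra.
Qed.

(** * Convergence of the growth series *)

Definition damp (s : R) (w : gword) : R := exp (- (s * INR (weight w))).

(* Fixed points of [canon K] represent each group element once, so the partial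
   sums are those of the growth series at exp (-s). *)
Definition summable (K : gword -> bool) (s : R) : Prop :=
  exists M, forall L, NoDup L -> (forall r, In r L -> canon K r = r) -> Rsum (damp s) L <= M.

Lemma damp_pos s w : 0 < damp s w.
Proof. apply exp_pos. Qed.

Lemma exp_le_mono x y : x <= y -> exp x <= exp y.
Proof. intros [H| ->]; [left; apply exp_increasing, H|right; reflexivity]. Qed.

Lemma damp_antitone s t w : s <= t -> damp t w <= damp s w.
Proof.
  intros H. apply exp_le_mono. pose proof (pos_INR (weight w)). nra.
Qed.

Lemma summable_mono K s t : s <= t -> summable K s -> summable K t.
Proof.
  intros H [M HM]. exists M. intros L H1 H2.
  eapply Rle_trans; [|apply HM; eassumption]. apply Rsum_le; intros; apply damp_antitone, H.
Qed.

(** Different words may share a coordinate, so duplicates are removed before the bound M is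
    applied. *)
Lemma Rsum_canon_le K s M (L : list gword) (f : gword -> gword) : normal_set K ->
  (forall L, NoDup L -> (forall r, In r L -> canon K r = r) -> Rsum (damp s) L <= M) ->
  exists R, (forall w, In w L -> In (canon K (f w)) R) /\ Rsum (damp s) R <= M.
Proof.
  intros HK HM.
  exists (nodup (list_eq_dec gletter_eq_dec) (map (fun w => canon K (f w)) L)). split.
  - intros w Hw. apply nodup_In, in_map_iff. eauto.
  - apply HM; [apply NoDup_nodup|]. intros r Hr. apply nodup_In, in_map_iff in Hr.
    destruct Hr as [w [<- _]]. apply canon_canon, HK.
Qed.

(** An element is determined by its parity and two coordinates, whose total weight is at most q
    times its own plus 16 q. Hence the series at exponent q s is at most exp (16 q s) times 2 M^2,
    the 2 counting the parities. *)
Lemma summable_step o K s : normal_set K -> 0 < s -> summable K s ->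
  summable (step o K) ((if o then 5 / 6 else 1) * s).
Proof.
  intros HK Hs [M HM].
  pose proof (normal_set_step o K HK) as HK'.
  set (q := if o then 5 / 6 else 1).
  assert (Hq : 0 < q) by (unfold q; destruct o; lra).
  exists (exp (q * s * 16) * (2 * (M * M))). intros L HL HLc.
  destruct (Rsum_canon_le K s M L (coord o false) HK HM) as [R0 [H0 HR0]].
  destruct (Rsum_canon_le K s M L (coord o true) HK HM) as [R1 [H1 HR1]].
  set (code := fun w => (parity w, (canon K (coord o false w), canon K (coord o true w)))).
  (* The factor 1 is the value at the parity; it gives h the product form that [Rsum_list_prod]
     expects. *)
  set (h := fun p : bool * (gword * gword) =>
    1 * (damp s (fst (snd p)) * damp s (snd (snd p)))).
  apply Rle_trans with (Rsum (fun w => exp (q * s * 16) * h (code w)) L).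
  { apply Rsum_le. intros w Hw. unfold h, code, damp; cbn [fst snd].
    rewrite Rmult_1_l, <- !exp_plus. apply exp_le_mono.
    assert (Ha : alternating w = true)
      by (rewrite <- (HLc w Hw); apply canon_alternating, HK').
    pose proof (weight_coords o w Ha) as Hw'.
    pose proof (weight_canon K HK (coord o false w)) as E0.
    pose proof (weight_canon K HK (coord o true w)) as E1.
    apply le_INR in E0, E1, Hw'. rewrite !mult_INR, !plus_INR in Hw'.
    set (x0 := INR (weight (canon K (coord o false w)))) in *.
    set (x1 := INR (weight (canon K (coord o true w)))) in *.
    assert (E : x0 + x1 <= q * (INR (weight w) + 16)).
    { unfold q; destruct o; cbn [INR] in Hw'; lra. }
    assert (s * (x0 + x1) <= s * (q * (INR (weight w) + 16)))
      by (apply Rmult_le_compat_l; lra).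
    lra. }
  rewrite Rsum_scal. apply Rmult_le_compat_l; [left; apply exp_pos|].
  rewrite <- Rsum_map.
  apply Rle_trans with (Rsum h (list_prod [true; false] (list_prod R0 R1))).
  - apply Rsum_incl.
    + intros p. unfold h. pose proof (damp_pos s (fst (snd p))).
      pose proof (damp_pos s (snd (snd p))). nra.
    (* The code is injective on canonical words: equal codes give congruent words by [geq_step], and
       congruent canonical words coincide. *)
    + clear HM H0 HR0 H1 HR1. induction HL as [|w L Hw HL IH]; cbn; constructor.
      * rewrite in_map_iff. intros [w' [E Hw']]. apply Hw.
        replace w with w'; [exact Hw'|].
        rewrite <- (HLc w (or_introl eq_refl)), <- (HLc w' (or_intror Hw')).
        apply (canon_eq _ HK'), geq_step. injection E as Ep E0 E1.
        split; [exact Ep|]. intros []; apply (canon_eq K HK); assumption.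
      * apply IH. intros r Hr. apply HLc; right; exact Hr.
    + intros p Hp. apply in_map_iff in Hp as [w [<- Hw]].
      apply in_prod; [destruct (parity w); cbn; auto|]. apply in_prod; auto.
  - unfold h. rewrite (Rsum_list_prod (fun _ : bool => 1)
      (fun p : gword * gword => damp s (fst p) * damp s (snd p))).
    rewrite (Rsum_list_prod (damp s) (damp s)).
    assert (P0 : 0 <= Rsum (damp s) R0) by (apply Rsum_ge0; intros; left; apply damp_pos).
    assert (P1 : 0 <= Rsum (damp s) R1) by (apply Rsum_ge0; intros; left; apply damp_pos).
    cbn [Rsum fold_right].
    change (fold_right (fun x r => damp s x + r) 0) with (Rsum (damp s)).
    assert (Rsum (damp s) R0 * Rsum (damp s) R1 <= M * M)
      by (apply Rmult_le_compat; assumption).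
    lra.
Qed.

Fixpoint gwords (k : nat) : list gword :=
  match k with
  | 0 => [[]]
  | S k' => map (fun p => fst p :: snd p) (list_prod [La; Lb; Lc; Ld] (gwords k'))
  end.

Lemma gwords_complete w : In w (gwords (length w)).
Proof.
  induction w as [|x w IH]; [left; reflexivity|].
  cbn [gwords length]. apply in_map_iff. exists (x, w). split; [reflexivity|].
  apply in_prod; [destruct x; cbn; auto|exact IH].
Qed.

(** The least letter weight is 9, so the four letters together contribute at most 4/8 at exponent
    1. *)
Lemma exp_opp_le_eighth t : 9 <= t -> 8 * exp (- t) <= 1.
Proof.
  intros H. rewrite exp_Ropp. pose proof (exp_ineq1_le t).
  assert (8 <= exp t) by lra.
  apply Rmult_le_reg_r with (exp t); [lra|].
  rewrite Rmult_assoc, Rinv_l by lra. lra.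
Qed.

Lemma Rsum_gwords k : Rsum (damp 1) (gwords k) <= (/ 2) ^ k.
Proof.
  induction k as [|k IH].
  - cbn. unfold damp; cbn. rewrite Rmult_0_r, Ropp_0, exp_0. lra.
  - cbn [gwords]. rewrite Rsum_map.
    apply Rle_trans with
      (Rsum (fun p => (fun x => exp (- INR (letter_weight x))) (fst p) * damp 1 (snd p))
        (list_prod [La; Lb; Lc; Ld] (gwords k))).
    + apply Rsum_le; intros [x w] _; cbn [fst snd]. right.
      unfold damp. rewrite <- exp_plus, weight_cons, plus_INR. f_equal; lra.
    + rewrite (Rsum_list_prod (fun x => exp (- INR (letter_weight x))) (damp 1)).
      cbn [pow]. apply Rmult_le_compat.
      * apply Rsum_ge0; intros; left; apply exp_pos.
      * apply Rsum_ge0; intros; left; apply damp_pos.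
      * assert (E : forall x, 8 * exp (- INR (letter_weight x)) <= 1)
          by (intros x; apply exp_opp_le_eighth; destruct x; cbn; lra).
        pose proof (E La); pose proof (E Lb); pose proof (E Lc); pose proof (E Ld).
        cbn [Rsum fold_right]. lra.
      * exact IH.
Qed.

(** The sum over all words already converges at exponent 1, being dominated by a geometric series of
    ratio 1/2, and canonical words are particular words. *)
Lemma summable_1 K : summable K 1.
Proof.
  exists 2. intros L HL _.
  set (m := list_max (map (@length _) L)).
  apply Rle_trans with (Rsum (damp 1) (flat_map gwords (seq 0 (S m)))).
  - apply Rsum_incl; [intros; left; apply damp_pos|exact HL|].
    intros w Hw. apply in_flat_map. exists (length w). split; [|apply gwords_complete].
    apply in_seq. split; [lia|]. apply Nat.lt_succ_r.
    assert (H := proj1 (list_max_le (map (@length _) L) m) (le_n _)).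
    rewrite Forall_forall in H. apply H, in_map_iff; eauto.
  - assert (H : forall a n, Rsum (damp 1) (flat_map gwords (seq a n)) <= 2 * (/ 2) ^ a).
    { intros a n; revert a; induction n as [|n IH]; intros a; cbn [seq flat_map].
      - cbn [Rsum fold_right]. pose proof (pow_lt (/ 2) a). lra.
      - rewrite Rsum_app. pose proof (Rsum_gwords a). specialize (IH (S a)).
        cbn [pow] in IH. lra. }
    specialize (H 0%nat (S m)). cbn [pow] in H. lra.
Qed.

(** The outer induction counts contractions. The inner one runs over the position p of some 1 in the
    sequence: the step at p yields a new factor 5/6, and the steps before it do not increase the
    exponent. *)
Lemma summable_limit j om : (forall m, exists k, (m <= k)%nat /\ om k = true) ->
  summable (limit_set om) ((5 / 6) ^ j).
Proof.
  revert om; induction j as [|j IH]; intros om H; [apply summable_1|].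
  destruct (H 0%nat) as [p [_ Hp]]. revert om H Hp.
  assert (Hpos : forall i, 0 < (5 / 6) ^ i) by (intros; apply pow_lt; lra).
  induction p as [|p IHp]; intros om H Hp; rewrite limit_set_step_ext.
  - rewrite Hp. apply (summable_step true); [apply normal_set_limit|apply Hpos|].
    apply IH. intros m. destruct (H (S m)) as [[|k] [H1 H2]]; [lia|].
    exists k; split; [lia|exact H2].
  - assert (Hs : summable (limit_set (fun i => om (S i))) ((5 / 6) ^ S j)).
    { apply IHp; [|exact Hp]. intros m. destruct (H (S m)) as [[|k] [H1 H2]]; [lia|].
      exists k; split; [lia|exact H2]. }
    apply (summable_mono _ ((if om 0%nat then 5 / 6 else 1) * (5 / 6) ^ S j)).
    + specialize (Hpos (S j)). destruct (om 0%nat); lra.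
    + apply summable_step; [apply normal_set_limit|apply Hpos|exact Hs].
Qed.

(** Each element of weight at most X contributes at least exp (- s X) to the series. *)
Lemma summable_count K s M X L : 0 < s ->
  (forall L, NoDup L -> (forall r, In r L -> canon K r = r) -> Rsum (damp s) L <= M) ->
  NoDup L -> (forall r, In r L -> canon K r = r /\ (weight r <= X)%nat) ->
  INR (length L) <= M * exp (s * INR X).
Proof.
  intros Hs HM HL HX.
  assert (H : INR (length L) * exp (- (s * INR X)) <= Rsum (damp s) L).
  { clear HL. induction L as [|w L IH]; [cbn; lra|].
    assert (E : exp (- (s * INR X)) <= damp s w).
    { apply exp_le_mono. destruct (HX w (or_introl eq_refl)) as [_ Hw].
      apply le_INR in Hw. nra. }
    cbn [length]. rewrite S_INR. cbn [Rsum fold_right].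
    fold (Rsum (damp s) L). specialize (IH (fun r h => HX r (or_intror h))). lra. }
  specialize (HM L HL (fun r h => proj1 (HX r h))).
  rewrite exp_Ropp in H. pose proof (exp_pos (s * INR X)).
  apply Rmult_le_reg_r with (/ exp (s * INR X)); [apply Rinv_0_lt_compat; assumption|].
  rewrite Rmult_assoc, Rinv_r by lra. lra.
Qed.

(** * Exponentially many elements when only finitely many steps contract *)

(** A form of exponential growth that lifts through steps: for every k, 2 ^ k distinct elements of
    length at most C k. *)
Definition exp_family (K : gword -> bool) (C : nat) : Prop :=
  exists E : list bool -> gword,
    (forall e, (length (E e) <= C * length e)%nat) /\
    (forall e e', length e = length e' -> geq K (E e) (E e') -> e = e').

(** A section of the coordinate at [false]: b has a there, and conjugation by a brings the
    coordinate at [true] of b, c or d to [false]. All these words have even parity. *)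
Definition lift_letter (o : bool) (x : gletter) : gword :=
  match x with
  | La => [Lb]
  | Lb => if o then [La; Ld; La] else [La; Lb; La]
  | Lc => if o then [La; Lb; La] else [La; Lc; La]
  | Ld => if o then [La; Lc; La] else [La; Ld; La]
  end.

Definition lift (o : bool) (u : gword) : gword := flat_map (lift_letter o) u.

Lemma coord_lift o u : coord o false (lift o u) = u.
Proof.
  induction u as [|x u IH]; [reflexivity|].
  unfold lift in *; cbn [flat_map]. rewrite coord_app.
  replace (parity (lift_letter o x)) with false by (destruct x, o; reflexivity).
  cbn [xorb]. rewrite IH. destruct x, o; reflexivity.
Qed.

Lemma length_lift o u : (length (lift o u) <= 3 * length u)%nat.
Proof.
  induction u as [|x u IH]; [cbn; lia|].
  unfold lift in *; cbn [flat_map]. rewrite length_app. destruct x, o; cbn in *; lia.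
Qed.

Lemma exp_family_step o K C : exp_family K C -> exp_family (step o K) (3 * C).
Proof.
  intros [E [H1 H2]]. exists (fun e => lift o (E e)). split.
  - intros e. pose proof (length_lift o (E e)). specialize (H1 e). nia.
  - intros e e' Hl H. apply H2; [exact Hl|]. apply geq_step in H as [_ H].
    specialize (H false). rewrite !coord_lift in H. exact H.
Qed.

(* Lamplighter-type words: b and c act in the same way up to the lamp d, and
   the conjugates of d by powers of ab behave like independent lamps. *)
Definition lamps (e : list bool) : gword :=
  flat_map (fun i : bool => (if i then [Ld] else []) ++ [La; Lb]) e.

(** The conjugate of [lamps e] by b, which arises as a coordinate at [false]. *)
Definition lamps' (e : list bool) : gword :=
  flat_map (fun i : bool => [Lb] ++ (if i then [Ld] else []) ++ [La]) e.

Lemma lamps'_b e : lamps' e ++ [Lb] = [Lb] ++ lamps e.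
Proof.
  induction e as [|i e IH]; [reflexivity|].
  cbn [lamps' lamps flat_map]. fold (lamps e) (lamps' e).
  rewrite <- !app_assoc, IH. destruct i; reflexivity.
Qed.

Lemma lamps_app e e' : lamps (e ++ e') = lamps e ++ lamps e'.
Proof. apply flat_map_app. Qed.

Lemma length_lamps e : (length (lamps e) <= 3 * length e)%nat.
Proof.
  induction e as [|i e IH]; [cbn; lia|].
  cbn [lamps flat_map]. fold (lamps e). rewrite length_app. destruct i; cbn in *; lia.
Qed.

Definition interleave (P : list (bool * bool)) : list bool :=
  flat_map (fun p => [fst p; snd p]) P.

Lemma interleave_ex m e : length e = (m + m)%nat ->
  exists P, length P = m /\ e = interleave P.
Proof.
  revert e; induction m as [|m IH]; intros e H.
  - exists []. destruct e; [split; reflexivity|discriminate H].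
  - destruct e as [|i [|j e]]; cbn in H; try lia.
    destruct (IH e) as [P [H1 H2]]; [lia|].
    exists ((i, j) :: P). cbn. rewrite H1, H2. split; reflexivity.
Qed.

Lemma interleave_inj (P Q : list (bool * bool)) :
  map fst P = map fst Q -> map snd P = map snd Q -> P = Q.
Proof.
  revert Q; induction P as [|[i j] P IH]; intros [|[i' j'] Q]; cbn; intros H1 H2;
    try discriminate; [reflexivity|].
  injection H1 as -> H1. injection H2 as -> H2. f_equal; auto.
Qed.

(** The block d^i ab d^j ab has coordinates d^i ab at [true] and b d^j a at [false], so the lamps at
    alternate positions separate into the two coordinates. *)
Lemma coord_lamps_interleave P :
  coord false true (lamps (interleave P)) = lamps (map fst P) /\
  coord false false (lamps (interleave P)) = lamps' (map snd P).
Proof.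
  induction P as [|[i j] P [IH1 IH2]]; [split; reflexivity|].
  change (interleave ((i, j) :: P)) with ([i; j] ++ interleave P).
  rewrite lamps_app, !coord_app.
  replace (parity (lamps [i; j])) with false by (destruct i, j; reflexivity).
  cbn [xorb]. rewrite IH1, IH2. destruct i, j; split; reflexivity.
Qed.

Lemma limit_set_d om : limit_set om [Ld] = false.
Proof. unfold limit_set; cbn. destruct (om 0%nat); reflexivity. Qed.

(** Induction by halving the list: one step separates its entries into two lists of half the length,
    each determined by the induction hypothesis. *)
Lemma lamps_pow2_inj k om e e' : (forall j, om j = false) ->
  length e = (2 ^ k)%nat -> length e' = (2 ^ k)%nat ->
  geq (limit_set om) (lamps e) (lamps e') -> e = e'.
Proof.
  revert om e e'; induction k as [|k IH]; intros om e e' Hom He He' H.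
  - cbn in He, He'. destruct e as [|i [|]]; try discriminate.
    destruct e' as [|i' [|]]; try discriminate.
    pose proof (normal_set_limit om) as HK.
    (* If the two lamps differ, conjugating the hypothesis by ab leaves d, which is not trivial. *)
    assert (Hd : limit_set om [Ld] = true -> [i] = [i'])
      by (rewrite limit_set_d; discriminate).
    destruct i, i'; try reflexivity; apply Hd;
      apply (fun h => ns_conj HK _ [La; Lb] h) in H;
      rewrite <- H; apply (ns_norm HK); reflexivity.
  - replace (2 ^ S k)%nat with (2 ^ k + 2 ^ k)%nat in He, He' by (cbn; lia).
    apply interleave_ex in He as [P [HP ->]], He' as [Q [HQ ->]].
    rewrite limit_set_step_ext, Hom in H. apply geq_step in H as [_ H].
    pose proof (H true) as H1. pose proof (H false) as H0. clear H.
    rewrite !(proj1 (coord_lamps_interleave _)) in H1.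
    rewrite !(proj2 (coord_lamps_interleave _)) in H0.
    pose proof (normal_set_limit (fun j => om (S j))) as HK.
    f_equal. apply interleave_inj.
    + apply (IH (fun j => om (S j))); rewrite ?length_map; auto.
    + apply (IH (fun j => om (S j))); rewrite ?length_map; auto.
      (* Multiplying by b on the right and then on the left undoes the conjugation in [lamps']. *)
      pose proof (geq_app _ HK _ _ _ _ H0 (geq_refl _ HK [Lb])) as H2.
      rewrite !lamps'_b in H2.
      pose proof (geq_app _ HK _ _ _ _ (geq_refl _ HK [Lb]) H2) as H3.
      refine (geq_trans _ HK _ _ _ _ (geq_trans _ HK _ _ _ H3 _));
        apply (geq_norm _ HK); [symmetry|]; apply norm_cancel.
Qed.

Lemma exp_family_false om : (forall j, om j = false) -> exp_family (limit_set om) 3.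
Proof.
  intros Hom. exists lamps. split; [apply length_lamps|].
  intros e e' Hl H.
  pose proof (normal_set_limit om) as HK.
  (* Both lists are padded with the same [false] entries to a length that is a power of two. *)
  set (k := length e). set (z := repeat false (2 ^ k - k)).
  assert (Hk : (k < 2 ^ k)%nat) by (apply Nat.pow_gt_lin_r; lia).
  apply app_inv_tail with z. apply (lamps_pow2_inj k om); auto.
  - unfold z. rewrite length_app, repeat_length. fold k. lia.
  - unfold z. rewrite length_app, repeat_length, <- Hl. fold k. lia.
  - rewrite !lamps_app. apply (geq_app _ HK); [exact H|apply (geq_refl _ HK)].
Qed.

Lemma exp_family_limit m om : (forall j, (m <= j)%nat -> om j = false) ->
  exists C, exp_family (limit_set om) C.
Proof.
  revert om; induction m as [|m IH]; intros om H.
  - exists 3%nat. apply exp_family_false. intros j; apply H; lia.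
  - destruct (IH (fun j => om (S j))) as [C HC]; [intros j Hj; apply H; lia|].
    exists (3 * C)%nat. rewrite limit_set_step_ext. apply exp_family_step, HC.
Qed.

(** * Encoding in the free group *)

(* A 2-generated subgroup of the wreath product of the 4-generated group with
   Z/4: gamma_1 is the cyclic shift of the four coordinates and gamma_0 has the
   four generators as its coordinates. The coordinates are indexed by the letters
   themselves, so that gamma_0 emits the current index. The remaining generators
   are trivial. *)
Definition next (y : gletter) : gletter :=
  match y with La => Lb | Lb => Lc | Lc => Ld | Ld => La end.
Definition prev (y : gletter) : gletter :=
  match y with La => Ld | Lb => La | Lc => Lb | Ld => Lc end.

Definition move (l : letter) (y : gletter) : gletter :=
  match fst l with 1%nat => if snd l then prev y else next y | _ => y end.

(** The sign of the letter is ignored because a, b, c, d are their own inverses. *)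
Definition emit (l : letter) (y : gletter) : gword :=
  match fst l with 0%nat => [y] | _ => [] end.

Fixpoint run (y : gletter) (w : list letter) : gletter :=
  match w with [] => y | l :: t => run (move l y) t end.

Fixpoint trace (y : gletter) (w : list letter) : gword :=
  match w with [] => [] | l :: t => emit l y ++ trace (move l y) t end.

Lemma run_app y u v : run y (u ++ v) = run (run y u) v.
Proof. revert y; induction u; intros; cbn; auto. Qed.

Lemma trace_app y u v : trace y (u ++ v) = trace y u ++ trace (run y u) v.
Proof.
  revert y; induction u as [|l u IH]; intros y; [reflexivity|].
  cbn. rewrite IH, app_assoc. reflexivity.
Qed.

Lemma length_trace y w : (length (trace y w) <= length w)%nat.
Proof.
  revert y; induction w as [|l w IH]; intros y; [cbn; lia|].
  cbn [trace]. rewrite length_app. specialize (IH (move l y)).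
  unfold emit. destruct (fst l); cbn; lia.
Qed.

(** Equality of the images in the wreath product of C_2 * V_4 with Z/4; [trace y] is the coordinate
    at y and [run] the cyclic part. *)
Definition same_action (u v : list letter) : Prop :=
  forall y, run y u = run y v /\ norm (trace y u) = norm (trace y v).

Lemma same_action_refl u : same_action u u.
Proof. split; reflexivity. Qed.

Lemma same_action_trans u v w : same_action u v -> same_action v w -> same_action u w.
Proof.
  intros H1 H2 y. destruct (H1 y) as [E1 E2], (H2 y) as [E3 E4]. split; congruence.
Qed.

Lemma same_action_app u u' v v' :
  same_action u u' -> same_action v v' -> same_action (u ++ v) (u' ++ v').
Proof.
  intros H1 H2 y. destruct (H1 y) as [E1 E2], (H2 (run y u)) as [E3 E4].
  rewrite !run_app, !trace_app, <- E1. split; [exact E3|].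
  apply norm_app_congr; assumption.
Qed.

Lemma move_inv_letter l y : move (inv_letter l) (move l y) = y.
Proof.
  destruct l as [[|[|i]] b]; try reflexivity. destruct b, y; reflexivity.
Qed.

Lemma emit_inv_letter l y : emit (inv_letter l) (move l y) = emit l y.
Proof. destruct l as [[|[|i]] b]; reflexivity. Qed.

Lemma is_inv_eq l m : is_inv l m = true -> m = inv_letter l.
Proof.
  unfold is_inv, letter_eqb. intros H. apply andb_prop in H as [H1 H2].
  apply Nat.eqb_eq in H1. apply eqb_prop in H2.
  destruct m, (inv_letter l); cbn in *; congruence.
Qed.

Lemma same_action_push l w : same_action (push l w) (l :: w).
Proof.
  destruct w as [|m w]; [apply same_action_refl|]. cbn [push].
  destruct (is_inv l m) eqn:E; [|apply same_action_refl].
  apply is_inv_eq in E as ->. intros y. cbn [run trace].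
  rewrite move_inv_letter, emit_inv_letter. split; [reflexivity|].
  unfold emit. destruct (fst l); [|reflexivity]. symmetry; apply norm_cancel.
Qed.

Lemma same_action_fold_push u v : same_action (fold_right push v u) (u ++ v).
Proof.
  induction u as [|l u IH]; [apply same_action_refl|]. cbn.
  apply same_action_trans with (l :: fold_right push v u); [apply same_action_push|].
  apply (same_action_app [l] [l]); [apply same_action_refl|exact IH].
Qed.

Definition inv_word (w : list letter) : list letter := map inv_letter (rev w).

Lemma inv_letter_involutive l : inv_letter (inv_letter l) = l.
Proof. destruct l as [i []]; reflexivity. Qed.

Lemma inv_word_involutive w : inv_word (inv_word w) = w.
Proof.
  unfold inv_word. rewrite <- map_rev, rev_involutive, map_map.
  rewrite (map_ext _ (fun l => l)); [apply map_id|apply inv_letter_involutive].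
Qed.

Lemma run_inv_word y w : run (run y w) (inv_word w) = y.
Proof.
  revert y; induction w as [|l w IH]; intros y; [reflexivity|].
  unfold inv_word in *. cbn [rev run]. rewrite map_app, run_app, IH.
  apply move_inv_letter.
Qed.

Lemma run_inv_word' y w : run (run y (inv_word w)) w = y.
Proof. rewrite <- (inv_word_involutive w) at 2. apply run_inv_word. Qed.

Lemma trace_inv_word y w : trace (run y w) (inv_word w) = rev (trace y w).
Proof.
  revert y; induction w as [|l w IH]; intros y; [reflexivity|].
  pose proof (run_inv_word (move l y) w) as Hr. specialize (IH (move l y)).
  unfold inv_word in *. cbn [rev run trace]. rewrite map_app, trace_app, IH, Hr.
  rewrite rev_app_distr. f_equal. cbn [map trace]. rewrite emit_inv_letter, app_nil_r.
  unfold emit. destruct (fst l); reflexivity.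
Qed.

Lemma proj1_mul n (g h : F n) :
  same_action (proj1_sig (mul g h)) (proj1_sig g ++ proj1_sig h).
Proof. apply same_action_fold_push. Qed.

Lemma proj1_inv n (g : F n) : same_action (proj1_sig (inv g)) (inv_word (proj1_sig g)).
Proof.
  cbn [inv proj1_sig]. unfold inv_word.
  replace (fold_left _ (proj1_sig g) [])
    with (fold_right push [] (map inv_letter (rev (proj1_sig g)))).
  - rewrite <- (app_nil_r (map _ _)) at 2. apply same_action_fold_push.
  - rewrite <- fold_left_rev_right. induction (rev (proj1_sig g)); cbn; congruence.
Qed.

Section Kernel.
Context (K : gword -> bool) (HK : normal_set K) (n : nat).

(** The kernel of the map from [F n] to the wreath product of the quotient by [K] with Z/4. *)
Definition kernel (g : F n) : bool :=
  forallb (fun y => (if gletter_eq_dec (run y (proj1_sig g)) y then true else false)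
                    && K (trace y (proj1_sig g))) [La; Lb; Lc; Ld].

Definition acts_trivially (w : list letter) : Prop :=
  forall y, run y w = y /\ K (trace y w) = true.

Lemma kernelP g : kernel g = true <-> acts_trivially (proj1_sig g).
Proof.
  unfold kernel. rewrite forallb_forall. split.
  - intros H y. specialize (H y).
    assert (Hy : In y [La; Lb; Lc; Ld]) by (destruct y; cbn; auto).
    apply H, andb_prop in Hy as [H1 H2]. split; [|exact H2].
    destruct (gletter_eq_dec _ _); [assumption|discriminate].
  - intros H y _. destruct (H y) as [H1 H2]. rewrite H2.
    destruct (gletter_eq_dec _ _); [reflexivity|contradiction].
Qed.

Lemma acts_trivially_same u v : same_action u v -> acts_trivially v -> acts_trivially u.
Proof.
  intros H Hv y. destruct (H y) as [E1 E2], (Hv y) as [H1 H2].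
  rewrite E1. split; [exact H1|]. rewrite (ns_norm HK _ _ E2). exact H2.
Qed.

Lemma same_action_sym u v : same_action u v -> same_action v u.
Proof. intros H y. destruct (H y); split; congruence. Qed.

Lemma kernel_normal : is_normal kernel.
Proof.
  split; [|split; [|split]].
  - apply kernelP. intros y. split; [reflexivity|apply (ns_nil HK)].
  - intros g h. rewrite !kernelP. intros Hg Hh.
    apply (acts_trivially_same _ _ (proj1_mul n g h)). intros y.
    destruct (Hg y) as [H1 H2], (Hh y) as [H3 H4].
    rewrite run_app, trace_app, H1. split; [exact H3|]. apply (ns_app HK); assumption.
  - intros g. rewrite !kernelP. intros Hg.
    apply (acts_trivially_same _ _ (proj1_inv n g)). intros y.
    destruct (Hg y) as [H1 H2].
    pose proof (run_inv_word y (proj1_sig g)) as H3.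
    pose proof (trace_inv_word y (proj1_sig g)) as H4. rewrite H1 in H3, H4.
    rewrite H3, H4. split; [reflexivity|apply (ns_rev HK), H2].
  - intros g h. rewrite !kernelP. intros Hh.
    set (u := proj1_sig g) in *. set (v := proj1_sig h) in *.
    assert (H : acts_trivially ((u ++ v) ++ inv_word u)).
    { intros y. destruct (Hh (run y u)) as [H1 H2].
      rewrite !run_app, !trace_app, run_app, H1, run_inv_word, trace_inv_word.
      split; [reflexivity|]. rewrite <- app_assoc. apply (ns_conj HK), H2. }
    refine (acts_trivially_same _ _ _ H).
    eapply same_action_trans; [apply proj1_mul|].
    apply same_action_app; [apply proj1_mul|apply proj1_inv].
Qed.

Definition action_eq (u v : list letter) : Prop :=
  forall y, run y u = run y v /\ geq K (trace y u) (trace y v).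

(** This translates the coset test in [Gamma] into a comparison of the four coordinates. *)
Lemma kernel_coset (h g : F n) :
  kernel (mul (inv h) g) = true <-> action_eq (proj1_sig h) (proj1_sig g).
Proof.
  rewrite kernelP. set (u := proj1_sig h). set (v := proj1_sig g).
  assert (S : same_action (proj1_sig (mul (inv h) g)) (inv_word u ++ v)).
  { eapply same_action_trans; [apply proj1_mul|].
    apply same_action_app; [apply proj1_inv|apply same_action_refl]. }
  split.
  - intros H z. apply (acts_trivially_same _ _ (same_action_sym _ _ S)) in H.
    (* Started at [run z u], the inverse of u leads back to z, from where v is read. *)
    destruct (H (run z u)) as [H1 H2].
    rewrite run_app, run_inv_word in H1. rewrite trace_app, trace_inv_word, run_inv_word in H2.
    split; [symmetry; exact H1|exact H2].
  - intros H. apply (acts_trivially_same _ _ S). intros y.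
    destruct (H (run y (inv_word u))) as [H1 H2].
    rewrite run_inv_word' in H1.
    pose proof (trace_inv_word (run y (inv_word u)) u) as H3. rewrite run_inv_word' in H3.
    rewrite run_app, trace_app, H3. split; [symmetry; exact H1|exact H2].
Qed.

Lemma action_eq_refl u : action_eq u u.
Proof. intros y; split; [reflexivity|apply geq_refl, HK]. Qed.

Lemma action_eq_cancel u v w : action_eq u v -> action_eq u w -> action_eq v w.
Proof.
  intros H1 H2 y. destruct (H1 y) as [E1 E2], (H2 y) as [E3 E4]. split; [congruence|].
  apply (geq_trans K HK) with (trace y u); [apply (geq_sym K HK), E2|exact E4].
Qed.

End Kernel.

(** * Balls and coset representatives *)

Lemma proj1_gen n l : Nat.ltb (fst l) n = true -> proj1_sig (gen n l) = [l].
Proof.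
  intros H. unfold gen.
  (* The boolean and its equation are generalised together so that the dependent match can be
     reduced. *)
  enough (E : forall b (e : Nat.ltb (fst l) n = b), b = true ->
    proj1_sig ((if b as b return (Nat.ltb (fst l) n = b -> F n)
      then fun H => exist _ [l] (single_valid n l H) else fun _ => one n) e) = [l])
    by (apply E; exact H).
  intros [] e Hb; [reflexivity|discriminate].
Qed.

Lemma proj1_evalF n w : Defs.bounded n w = true -> same_action (proj1_sig (evalF n w)) w.
Proof.
  induction w as [|l w IH]; intros H; [apply same_action_refl|].
  cbn in H. apply andb_prop in H as [H1 H2].
  change (evalF n (l :: w)) with (mul (gen n l) (evalF n w)).
  eapply same_action_trans; [apply proj1_mul|]. rewrite proj1_gen by exact H1.
  apply (same_action_app [l] [l]); [apply same_action_refl|exact (IH H2)].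
Qed.

Lemma in_letters n l : In l (letters n) <-> Nat.ltb (fst l) n = true.
Proof.
  unfold letters. rewrite in_flat_map, Nat.ltb_lt. split.
  - intros [i [Hi Hl]]. apply in_seq in Hi. destruct Hl as [<-|[<-|[]]]; cbn; lia.
  - intros H. exists (fst l). split; [apply in_seq; lia|].
    destruct l as [i []]; cbn; auto.
Qed.

Lemma in_words n k w : In w (words n k) <-> length w = k /\ Defs.bounded n w = true.
Proof.
  revert w; induction k as [|k IH]; intros w; cbn [words].
  - split.
    + intros [<-|[]]; split; reflexivity.
    + intros [H _]. destruct w; [left; reflexivity|discriminate].
  - rewrite in_flat_map. split.
    + intros [v [Hv Hw]]. apply IH in Hv as [H1 H2]. apply in_map_iff in Hw as [l [<- Hl]].
      apply in_letters in Hl. split; [cbn; congruence|].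
      apply andb_true_intro; split; assumption.
    + intros [H1 H2]. destruct w as [|l w]; [discriminate|].
      cbn in H1, H2. apply andb_prop in H2 as [H2 H3].
      exists w. split; [apply IH; split; [congruence|exact H3]|].
      apply in_map_iff. exists l. split; [reflexivity|apply in_letters, H2].
Qed.

Lemma in_ball n x g :
  In g (ball n x) <-> exists w, g = evalF n w /\ (length w <= x)%nat /\ Defs.bounded n w = true.
Proof.
  unfold ball. rewrite in_map_iff. split.
  - intros [w [<- Hw]]. apply in_flat_map in Hw as [k [Hk Hw]].
    apply in_seq in Hk. apply in_words in Hw as [H1 H2]. exists w. repeat split; auto; lia.
  - intros [w [-> [H1 H2]]]. exists w. split; [reflexivity|].
    apply in_flat_map. exists (length w). split; [apply in_seq; lia|].
    apply in_words; auto.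
Qed.

Section CosetReps.
Context (n : nat) (N : F n -> bool).

Definition add_rep (reps : list (F n)) (g : F n) : list (F n) :=
  if existsb (fun h => N (mul (inv h) g)) reps then reps else g :: reps.

Lemma fold_add_rep_incl l acc : incl acc (fold_left add_rep l acc).
Proof.
  revert acc; induction l as [|g l IH]; intros acc; [apply incl_refl|].
  cbn. intros h Hh. apply IH. unfold add_rep.
  destruct (existsb _ _); [exact Hh|right; exact Hh].
Qed.

Lemma fold_add_rep_cover l acc g : (forall g, N (mul (inv g) g) = true) ->
  In g l -> exists h, In h (fold_left add_rep l acc) /\ N (mul (inv h) g) = true.
Proof.
  intros Hr; revert acc; induction l as [|g' l IH]; intros acc H; [destruct H|].
  destruct H as [->|H]; [|apply IH, H]. cbn.
  destruct (existsb (fun h => N (mul (inv h) g)) acc) eqn:E.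
  - apply existsb_exists in E as [h [H1 H2]]. exists h. split; [|exact H2].
    apply fold_add_rep_incl. unfold add_rep. destruct (existsb _ _); [exact H1|right; exact H1].
  - exists g. split; [|apply Hr]. apply fold_add_rep_incl.
    unfold add_rep. rewrite E. left; reflexivity.
Qed.

Lemma fold_add_rep_in l acc g : In g (fold_left add_rep l acc) -> In g acc \/ In g l.
Proof.
  revert acc; induction l as [|g' l IH]; intros acc H; [left; exact H|].
  cbn in H. apply IH in H as [H|H]; [|right; right; exact H].
  unfold add_rep in H. destruct (existsb _ _); [left; exact H|].
  destruct H as [<-|H]; [right; left; reflexivity|left; exact H].
Qed.

Lemma NoDup_map_fold_add_rep {T} (code : F n -> T) l acc :
  (forall g h, code g = code h -> N (mul (inv h) g) = true) ->
  NoDup (map code acc) -> NoDup (map code (fold_left add_rep l acc)).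
Proof.
  intros Hc; revert acc; induction l as [|g l IH]; intros acc H; [exact H|].
  cbn. apply IH. unfold add_rep. destruct (existsb _ _) eqn:E; [exact H|].
  cbn. constructor; [|exact H]. intros Hi. apply in_map_iff in Hi as [h [E' Hh]].
  rewrite <- not_true_iff_false, existsb_exists in E. apply E.
  exists h. split; [exact Hh|]. apply Hc; auto.
Qed.

(** Sending i to a chosen representative of the coset of [f i] is injective on [L]. *)
Lemma Gamma_ge {I} (f : I -> F n) (L : list I) x :
  (forall g, N (mul (inv g) g) = true) ->
  (forall h g g', N (mul (inv h) g) = true -> N (mul (inv h) g') = true ->
    N (mul (inv g) g') = true) ->
  NoDup L -> (forall i, In i L -> In (f i) (ball n x)) ->
  (forall i j, In i L -> In j L -> N (mul (inv (f i)) (f j)) = true -> i = j) ->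
  (length L <= Gamma N x)%nat.
Proof.
  intros Hr Ht HL Hb Hi. unfold Gamma.
  change (coset_reps N (ball n x)) with (fold_left add_rep (ball n x) []).
  set (reps := fold_left add_rep (ball n x) []).
  (* The default [f i] is never reached for i in [L], since the representatives cover the ball. *)
  set (r := fun i => match find (fun h => N (mul (inv h) (f i))) reps with
                     | Some h => h | None => f i end).
  assert (Hr' : forall i, In i L -> In (r i) reps /\ N (mul (inv (r i)) (f i)) = true).
  { intros i HiL. unfold r. destruct (find _ reps) as [h|] eqn:E.
    - apply find_some in E. exact E.
    - destruct (fold_add_rep_cover (ball n x) [] (f i) Hr (Hb i HiL)) as [h [H1 H2]].
      pose proof (find_none _ _ E h H1) as H3. cbn in H3. congruence. }
  rewrite <- (length_map r L). apply NoDup_incl_length.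
  - clear Hb. induction HL as [|i L Hi' HL IH]; cbn; constructor.
    + intros H. apply in_map_iff in H as [j [E Hj]]. apply Hi'.
      replace i with j; [exact Hj|]. symmetry. apply Hi; [left; reflexivity|right; exact Hj|].
      destruct (Hr' i (or_introl eq_refl)) as [_ H1].
      destruct (Hr' j (or_intror Hj)) as [_ H2]. rewrite E in H2.
      apply (Ht (r i)); assumption.
    + apply IH; intros.
      * apply Hi; [right|right|]; assumption.
      * apply Hr'; right; assumption.
  - intros h Hh. apply in_map_iff in Hh as [i [<- HiL]]. apply Hr', HiL.
Qed.

Lemma Gamma_le {T} (code : F n -> T) (Q : list T) x :
  (forall g h, code g = code h -> N (mul (inv h) g) = true) ->
  (forall g, In g (ball n x) -> In (code g) Q) ->
  (Gamma N x <= length Q)%nat.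
Proof.
  intros Hc HQ. unfold Gamma.
  change (coset_reps N (ball n x)) with (fold_left add_rep (ball n x) []).
  rewrite <- (length_map code). apply NoDup_incl_length.
  - apply NoDup_map_fold_add_rep; [exact Hc|constructor].
  - intros c Hi. apply in_map_iff in Hi as [g [<- Hg]].
    apply fold_add_rep_in in Hg as [[]|Hg]. apply HQ, Hg.
Qed.

End CosetReps.

(** * Growth of the quotients *)

Lemma exp_mult_INR t k : exp t ^ k = exp (INR k * t).
Proof.
  induction k as [|k IH]; [cbn; rewrite Rmult_0_l, exp_0; reflexivity|].
  cbn [pow]. rewrite IH, <- exp_plus, S_INR. f_equal; lra.
Qed.

(** A coset is determined by four pairs of a final index and a canonical coordinate. There are 4
    indices, and a word of length at most x has coordinates of weight at most 20 x. *)
Lemma Gamma_kernel_le K n s M x : normal_set K -> 0 < s ->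
  (forall L, NoDup L -> (forall r, In r L -> canon K r = r) -> Rsum (damp s) L <= M) ->
  INR (Gamma (kernel K n) x) <= (4 * (M * exp (s * INR (20 * x)))) ^ 4.
Proof.
  intros HK Hs HM.
  set (ys := [La; Lb; Lc; Ld]).
  set (c := fun (y : gletter) (g : F n) => canon K (trace y (proj1_sig g))).
  set (reps := nodup (list_eq_dec gletter_eq_dec)
              (flat_map (fun g => map (fun y => c y g) ys) (ball n x))).
  set (Q := list_prod ys reps).
  set (code1 := fun y (g : F n) => (run y (proj1_sig g), c y g)).
  set (code := fun g => (code1 La g, (code1 Lb g, (code1 Lc g, code1 Ld g)))).
  assert (HR : INR (length reps) <= M * exp (s * INR (20 * x))).
  { apply (summable_count K); auto; [apply NoDup_nodup|].
    intros r Hr. apply nodup_In, in_flat_map in Hr as [g [Hg Hr]].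
    apply in_map_iff in Hr as [y [<- _]]. unfold c. split; [apply canon_canon, HK|].
    apply in_ball in Hg as [w [-> [H1 H2]]].
    replace (canon K (trace y (proj1_sig (evalF n w)))) with (canon K (trace y w)).
    - etransitivity; [apply weight_canon, HK|].
      pose proof (weight_le_length (trace y w)). pose proof (length_trace y w). lia.
    - symmetry. apply (canon_eq K HK), (geq_norm K HK). apply (proj1_evalF n w H2 y). }
  assert (HQ : (Gamma (kernel K n) x <= length (list_prod Q (list_prod Q (list_prod Q Q))))%nat).
  { apply (Gamma_le n _ code).
    - intros g h E. apply (kernel_coset K HK).
      assert (E' : forall y, code1 y g = code1 y h)
        by (injection E; intros; destruct y; unfold code1; congruence).
      intros y. specialize (E' y). injection E' as E1 E2. split; [congruence|].
      apply (canon_eq K HK). symmetry; exact E2.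
    - intros g Hg.
      assert (H : forall y, In (code1 y g) Q).
      { intros y. assert (Hy : In y ys) by (destruct y; cbn; auto).
        apply in_prod; [destruct (run y (proj1_sig g)); cbn; auto|].
        apply nodup_In, in_flat_map. exists g. split; [exact Hg|].
        apply in_map_iff; eauto. }
      do 3 (apply in_prod; [apply H|]). apply H. }
  apply le_INR in HQ. eapply Rle_trans; [exact HQ|].
  assert (E : INR (length (list_prod Q (list_prod Q (list_prod Q Q))))
              = (4 * INR (length reps)) ^ 4).
  { unfold Q. rewrite !length_prod, !mult_INR.
    replace (INR (length ys)) with 4 by (rewrite INR_IZR_INZ; reflexivity). ring. }
  rewrite E.
  apply pow_incr. split; [apply Rmult_le_pos; [lra|apply pos_INR]|].
  apply Rmult_le_compat_l; [lra|exact HR].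
Qed.

Lemma not_exp_growth_kernel K n : normal_set K -> (forall s, 0 < s -> summable K s) ->
  ~ exp_growth (kernel K n).
Proof.
  intros HK Hsum [a [Ha Hg]].
  assert (Hln : 0 < ln a) by (rewrite <- ln_1; apply ln_increasing; lra).
  (* The fourth power and the factor 20 turn this exponent into ln a / 2, so the upper bound grows
     only like the square root of a ^ x. *)
  destruct (Hsum (ln a / 160)) as [M HM]; [lra|].
  set (A := (4 * M) ^ 4).
  assert (H : forall x, (1 <= x)%nat -> 1 + INR x * (ln a / 2) <= A).
  { intros x Hx. specialize (Hg x Hx).
    pose proof (Gamma_kernel_le K n (ln a / 160) M x HK ltac:(lra) HM) as H.
    assert (E : (4 * (M * exp (ln a / 160 * INR (20 * x)))) ^ 4
                = A * exp (INR x * (ln a / 2))).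
    { unfold A. rewrite <- Rmult_assoc, Rpow_mult_distr, exp_mult_INR. do 2 f_equal.
      rewrite mult_INR. cbn [INR]. field. }
    rewrite E in H.
    assert (E2 : a ^ x = exp (INR x * (ln a / 2)) * exp (INR x * (ln a / 2))).
    { rewrite <- exp_plus, <- (exp_ln a) at 1 by lra. rewrite exp_mult_INR. f_equal. field. }
    rewrite E2 in Hg. pose proof (exp_pos (INR x * (ln a / 2))) as Hp.
    pose proof (exp_ineq1_le (INR x * (ln a / 2))).
    apply Rle_trans with (exp (INR x * (ln a / 2))); [assumption|].
    apply Rmult_le_reg_r with (exp (INR x * (ln a / 2))); [exact Hp|]. lra. }
  destruct (INR_unbounded (A / (ln a / 2))) as [x Hx].
  specialize (H (S x) ltac:(lia)). rewrite S_INR in H.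
  apply (Rmult_lt_compat_r (ln a / 2)) in Hx; [|lra].
  unfold Rdiv at 1 in Hx. rewrite Rmult_assoc, Rinv_l in Hx by lra. lra.
Qed.

Fixpoint bool_lists (k : nat) : list (list bool) :=
  match k with
  | 0 => [[]]
  | S k' => map (cons true) (bool_lists k') ++ map (cons false) (bool_lists k')
  end.

Lemma bool_lists_spec k :
  length (bool_lists k) = (2 ^ k)%nat /\ NoDup (bool_lists k) /\
  forall e, In e (bool_lists k) -> length e = k.
Proof.
  induction k as [|k [H1 [H2 H3]]]; cbn [bool_lists].
  - repeat split; [constructor; [intros []|constructor]|]. intros e [<-|[]]; reflexivity.
  - split; [|split].
    + rewrite length_app, !length_map, H1. cbn; lia.
    + apply NoDup_app.
      * apply NoDup_map_inv with (f := @tl bool). rewrite map_map, map_id. exact H2.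
      * apply NoDup_map_inv with (f := @tl bool). rewrite map_map, map_id. exact H2.
      * intros e He He'. apply in_map_iff in He as [u [<- _]].
        apply in_map_iff in He' as [v [E _]]. discriminate.
    + intros e He. apply in_app_iff in He as [He|He];
        apply in_map_iff in He as [u [<- Hu]]; cbn; f_equal; apply H3, Hu.
Qed.

(** Conjugates of gamma_0 by powers of gamma_1: started at [La], the word moves to index x, emits x
    there and returns. *)
Definition encode_letter (x : gletter) : list letter :=
  let g := (0%nat, false) in let t := (1%nat, false) in let t' := (1%nat, true) in
  match x with
  | La => [g]
  | Lb => [t; g; t']
  | Lc => [t; t; g; t'; t']
  | Ld => [t'; g; t]
  end.

Definition encode (u : gword) : list letter := flat_map encode_letter u.

Lemma trace_encode u : trace La (encode u) = u.
Proof.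
  induction u as [|x u IH]; [reflexivity|].
  unfold encode in *. cbn [flat_map]. rewrite trace_app.
  replace (run La (encode_letter x)) with La by (destruct x; reflexivity).
  rewrite IH. destruct x; reflexivity.
Qed.

Lemma length_encode u : (length (encode u) <= 5 * length u)%nat.
Proof.
  induction u as [|x u IH]; [cbn; lia|].
  unfold encode in *. cbn [flat_map]. rewrite length_app. destruct x; cbn in *; lia.
Qed.

Lemma bounded_encode n u : (1 < n)%nat -> Defs.bounded n (encode u) = true.
Proof.
  intros Hn. unfold Defs.bounded. apply forallb_forall. intros l Hl.
  apply Nat.ltb_lt. apply in_flat_map in Hl as [x [_ Hl]].
  destruct x; cbn in Hl; repeat (destruct Hl as [<-|Hl]; [cbn; lia|]); destruct Hl.
Qed.

Lemma exp_growth_kernel K n C : (1 < n)%nat -> normal_set K -> exp_family K C ->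
  exp_growth (kernel K n).
Proof.
  intros Hn HK [E [HE1 HE2]].
  assert (Hr : forall g : F n, kernel K n (mul (inv g) g) = true).
  { intros g. apply (kernel_coset K HK), (action_eq_refl K HK). }
  assert (Ht : forall h g g' : F n, kernel K n (mul (inv h) g) = true ->
    kernel K n (mul (inv h) g') = true -> kernel K n (mul (inv g) g') = true).
  { intros h g g'. rewrite !(kernel_coset K HK). apply (action_eq_cancel K HK). }
  (* Encoding costs a factor 5; the summand 1 makes c positive. *)
  set (c := (5 * C + 1)%nat).
  assert (H1 : forall x k, (c * k <= x)%nat -> (2 ^ k <= Gamma (kernel K n) x)%nat).
  { intros x k Hx. destruct (bool_lists_spec k) as [L1 [L2 L3]]. rewrite <- L1.
    apply (Gamma_ge n _ (fun e => evalF n (encode (E e)))); auto.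
    - intros e He. apply in_ball. exists (encode (E e)).
      split; [reflexivity|]. split; [|apply bounded_encode, Hn].
      pose proof (length_encode (E e)). specialize (HE1 e). rewrite (L3 e He) in HE1.
      unfold c in Hx. nia.
    - intros e e' He He' H. apply HE2; [rewrite !L3 by assumption; reflexivity|].
      apply (kernel_coset K HK) in H. destruct (H La) as [_ H'].
      destruct (proj1_evalF n (encode (E e)) (bounded_encode n _ Hn) La) as [_ N1].
      destruct (proj1_evalF n (encode (E e')) (bounded_encode n _ Hn) La) as [_ N2].
      rewrite trace_encode in N1, N2.
      apply (geq_trans K HK) with (trace La (proj1_sig (evalF n (encode (E e))))).
      + apply (geq_sym K HK), (geq_norm K HK), N1.
      + refine (geq_trans K HK _ _ _ H' _). apply (geq_norm K HK), N2. }
  (* For x < c the family may give only one element; here 1 and gamma_1 are told apart by the cyclic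
     part. *)
  assert (H2 : forall x, (1 <= x)%nat -> (2 <= Gamma (kernel K n) x)%nat).
  { intros x Hx. change 2%nat with (length [true; false]).
    set (w := fun b : bool => if b then [(1%nat, false)] else []).
    assert (Hw : forall b, Defs.bounded n (w b) = true).
    { intros []; [|reflexivity]. apply andb_true_intro. split; [apply Nat.ltb_lt, Hn|reflexivity]. }
    apply (Gamma_ge n _ (fun b : bool => evalF n (w b))); auto.
    - repeat constructor; cbn; intuition discriminate.
    - intros b _. apply in_ball. exists (w b). repeat split; auto. destruct b; cbn; lia.
    - intros i j _ _ H. apply (kernel_coset K HK) in H. destruct (H La) as [H' _].
      rewrite (proj1 (proj1_evalF n (w i) (Hw i) La)) in H'.
      rewrite (proj1 (proj1_evalF n (w j) (Hw j) La)) in H'.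
      destruct i, j; cbn in H'; congruence. }
  assert (Hc : 1 <= INR c) by (apply (le_INR 1); unfold c; lia).
  assert (Hl : 0 < ln 2) by (rewrite <- ln_1; apply ln_increasing; lra).
  (* The base is 2 to the power 1/(2c). For x >= c the quotient k of x by c satisfies x <= 2 c k,
     which gives the bound 2 ^ k; for x < c the bound 2 suffices. *)
  set (t := ln 2 / (2 * INR c)).
  assert (Ht0 : 0 < t) by (apply Rdiv_lt_0_compat; lra).
  assert (Htc : 2 * INR c * t = ln 2) by (unfold t; field; lra).
  exists (exp t). split; [rewrite <- exp_0; apply exp_increasing, Ht0|].
  intros x Hx. rewrite exp_mult_INR.
  destruct (le_lt_dec c x) as [Hcx|Hcx].
  - set (k := (x / c)%nat).
    assert (Hk : (c * k <= x < c * S k)%nat).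
    { unfold k. split; [apply Nat.Div0.mul_div_le|apply Nat.mul_succ_div_gt; unfold c; lia]. }
    apply Rle_trans with (INR (2 ^ k)); [|apply le_INR, H1, Hk].
    rewrite pow_INR. replace (INR 2) with (exp (ln 2)) by (rewrite exp_ln; cbn; lra).
    rewrite exp_mult_INR. apply exp_le_mono. rewrite <- Htc.
    assert (Hk0 : (1 <= k)%nat) by (destruct k; lia).
    assert (Hx2 : (x <= 2 * c * k)%nat) by (clearbody k c; nia).
    apply le_INR in Hx2. rewrite !mult_INR in Hx2. change (INR 2) with 2 in Hx2.
    replace (INR k * (2 * INR c * t)) with (2 * INR c * INR k * t) by ring.
    apply Rmult_le_compat_r; lra.
  - apply Rle_trans with 2.
    + rewrite <- (exp_ln 2) by lra. apply exp_le_mono. rewrite <- Htc.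
      apply lt_INR in Hcx. apply Rmult_le_compat_r; lra.
    + apply (le_INR 2), H2, Hx.
Qed.

(** * The Borel class *)

Lemma coset_reps_local n (N N' : F n -> bool) l :
  (forall h g, In h l -> In g l -> N' (mul (inv h) g) = N (mul (inv h) g)) ->
  coset_reps N' l = coset_reps N l.
Proof.
  intros H. unfold coset_reps.
  (* Every test made by the fold compares two members of l, as the accumulator stays within l. *)
  assert (G : forall m acc, incl m l -> incl acc l ->
    fold_left (add_rep n N') m acc = fold_left (add_rep n N) m acc).
  { induction m as [|g m IH]; intros acc Hm Hacc; [reflexivity|]. cbn.
    assert (E : add_rep n N' acc g = add_rep n N acc g).
    { unfold add_rep.
      replace (existsb (fun h => N' (mul (inv h) g)) acc)
        with (existsb (fun h => N (mul (inv h) g)) acc); [reflexivity|].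
      apply eq_true_iff_eq. rewrite !existsb_exists.
      assert (Hg : In g l) by (apply Hm; left; reflexivity).
      split; intros [h [H1 H2]]; exists h; split; auto;
        [rewrite H|rewrite <- H]; auto. }
    rewrite E. apply IH.
    - intros h Hh; apply Hm; right; exact Hh.
    - unfold add_rep. destruct (existsb _ _); [exact Hacc|].
      intros h [<-|Hh]; [apply Hm; left; reflexivity|apply Hacc, Hh]. }
  apply (G l []); [apply incl_refl|intros h []].
Qed.

Lemma Gamma_local n (N : F n -> bool) x :
  exists l, forall N', (forall g, In g l -> N' g = N g) -> Gamma N' x = Gamma N x.
Proof.
  exists (map (fun p => mul (inv (fst p)) (snd p)) (list_prod (ball n x) (ball n x))).
  intros N' H. unfold Gamma. f_equal. apply coset_reps_local. intros h g Hh Hg. apply H.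
  apply in_map_iff. exists (h, g). split; [reflexivity|apply in_prod; assumption].
Qed.

Definition growth_at_least (n k : nat) (N : F n -> bool) : Prop :=
  forall x, (1 <= x)%nat -> (1 + / INR (S k)) ^ x <= INR (Gamma N x).

(** A failure occurs at a single x, where it depends on finitely many coordinates. *)
Lemma closedX_growth_at_least n k : closedX (growth_at_least n k).
Proof.
  intros N HN. apply not_all_ex_not in HN as [x HN].
  destruct (Gamma_local n N x) as [l Hl]. exists l. intros N' H' HN'.
  apply HN. intros Hx. rewrite <- (Hl N' H'). apply HN', Hx.
Qed.

Lemma exp_growth_iff n (N : F n -> bool) : exp_growth N <-> exists k, growth_at_least n k N.
Proof.
  split.
  - intros [a [Ha H]]. destruct (archimed_cor1 (a - 1)) as [k [Hk Hk0]]; [lra|].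
    exists k. intros x Hx. eapply Rle_trans; [|apply H, Hx]. apply pow_incr.
    assert (0 < INR k) by (apply lt_0_INR; lia).
    assert (/ INR (S k) <= / INR k) by (apply Rinv_le_contravar; [|apply le_INR]; auto).
    assert (0 < / INR (S k)) by (apply Rinv_0_lt_compat, lt_0_INR; lia). lra.
  - intros [k H]. exists (1 + / INR (S k)). split; [|exact H].
    assert (0 < / INR (S k)) by (apply Rinv_0_lt_compat, lt_0_INR; lia). lra.
Qed.

Lemma Sigma02_ExpGrowthSet n : Sigma02_Gn (ExpGrowthSet (n := n)).
Proof.
  exists (growth_at_least n). split; [apply closedX_growth_at_least|].
  intros N. unfold ExpGrowthSet. rewrite exp_growth_iff. reflexivity.
Qed.

(** * Reduction of Sigma^0_2 sets to eventually vanishing sequences *)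

Lemma function_choice {A B} (P : A -> B -> Prop) :
  (forall x, exists y, P x y) -> exists f, forall x, P x (f x).
Proof.
  intros H. exists (fun x => proj1_sig (constructive_indefinite_description _ (H x))).
  intros x. apply proj2_sig.
Qed.

Section ZeroDim.
Context {Y : Type} (d : Y -> Y -> R).
Context (Hd : is_metric d) (Hsep : m_separable d) (Hzd : m_zero_dim d).

Definition clopen (V : Y -> Prop) : Prop := mopen d V /\ mclosed d V.

Lemma mopen_and U V : mopen d U -> mopen d V -> mopen d (fun y => U y /\ V y).
Proof.
  intros HU HV y [Hy1 Hy2].
  destruct (HU y Hy1) as [e1 [E1 H1]], (HV y Hy2) as [e2 [E2 H2]].
  exists (Rmin e1 e2). split; [apply Rmin_pos; assumption|].
  intros z Hz. pose proof (Rmin_l e1 e2). pose proof (Rmin_r e1 e2).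
  split; [apply H1|apply H2]; lra.
Qed.

Lemma mopen_or U V : mopen d U -> mopen d V -> mopen d (fun y => U y \/ V y).
Proof.
  intros HU HV y [Hy|Hy]; [destruct (HU y Hy) as [e [E H]]|destruct (HV y Hy) as [e [E H]]];
    exists e; split; auto.
Qed.

Lemma mopen_ext (U V : Y -> Prop) : (forall y, U y <-> V y) -> mopen d U -> mopen d V.
Proof.
  intros H HU y Hy. destruct (HU y) as [e [E He]]; [apply H, Hy|].
  exists e; split; [exact E|]. intros z Hz. apply H, He, Hz.
Qed.

Lemma clopen_empty : clopen (fun _ => False).
Proof.
  split; [intros y []|]. intros y _. exists 1. split; [lra|]. tauto.
Qed.

Lemma clopen_or U V : clopen U -> clopen V -> clopen (fun y => U y \/ V y).
Proof.
  intros [U1 U2] [V1 V2]. split; [apply mopen_or; assumption|].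
  unfold mclosed. apply mopen_ext with (fun y => ~ U y /\ ~ V y); [tauto|].
  apply mopen_and; assumption.
Qed.

(** A Lindelof argument: j codes a ball of radius 1/(m+1) about a point of the dense sequence. If
    the ball lies in a clopen subset of U, one such set is chosen, otherwise the empty set. *)
Lemma open_clopen_cover U : mopen d U -> exists V : nat -> Y -> Prop,
  (forall j, clopen (V j)) /\ forall y, U y <-> exists j, V j y.
Proof.
  intros HU. destruct Hsep as [s Hs].
  assert (H : forall p : nat, exists V : Y -> Prop, clopen V /\ (forall z, V z -> U z) /\
    forall y, s (fst (of_nat p)) = Some y ->
    (exists W, clopen W /\ (forall z, W z -> U z) /\
               forall z, d y z < / INR (S (snd (of_nat p))) -> W z) ->
    forall z, d y z < / INR (S (snd (of_nat p))) -> V z).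
  { intros p. destruct (classic (exists y W, s (fst (of_nat p)) = Some y /\ clopen W /\
      (forall z, W z -> U z) /\ forall z, d y z < / INR (S (snd (of_nat p))) -> W z))
      as [[y [W [H1 [H2 [H3 H4]]]]]|Hn].
    - exists W. split; [exact H2|]. split; [exact H3|]. intros y' Hy' _.
      replace y' with y by congruence. exact H4.
    - exists (fun _ => False). split; [apply clopen_empty|]. split; [tauto|].
      intros y Hy [W HW]. exfalso; apply Hn. exists y, W. tauto. }
  destruct (function_choice _ H) as [V HV].
  exists V. split.
  - intros j. apply (HV j).
  - intros y; split.
    + intros Hy. destruct (Hzd U y HU Hy) as [W [W1 [W2 [W3 W4]]]].
      destruct (W1 y W3) as [e [He Hball]].
      (* With radius below e / 2, a ball whose centre is that close to y stays within distance e of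
         y. *)
      destruct (archimed_cor1 (e / 2)) as [m [Hm Hm0]]; [lra|].
      assert (Hp : 0 < / INR (S m)) by (apply Rinv_0_lt_compat, lt_0_INR; lia).
      assert (Hm' : / INR (S m) <= / INR m)
        by (apply Rinv_le_contravar; [apply lt_0_INR; lia|apply le_INR; lia]).
      destruct (Hs y _ Hp) as [k [y' [Hk Hy']]].
      destruct Hd as [_ [_ [Hsym Htri]]].
      destruct (HV (to_nat (k, m))) as [_ [_ HW']].
      rewrite cancel_of_to in HW'. cbn [fst snd] in HW'. exists (to_nat (k, m)).
      apply (HW' y' Hk); [|rewrite Hsym; exact Hy'].
      exists W. split; [split; assumption|]. split; [exact W4|].
      intros z Hz. apply Hball. specialize (Htri y y' z). lra.
    + intros [j Hj]. destruct (HV j) as [_ [HW _]]. apply HW, Hj.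
Qed.

Lemma open_clopen_exhaustion U : mopen d U -> exists V : nat -> Y -> Prop,
  (forall j, clopen (V j)) /\ (forall i j y, (i <= j)%nat -> V i y -> V j y) /\
  forall y, U y <-> exists j, V j y.
Proof.
  intros HU. destruct (open_clopen_cover U HU) as [V [H1 H2]].
  set (W := nat_rect (fun _ => Y -> Prop) (V 0%nat) (fun j Wj y => Wj y \/ V (S j) y)).
  exists W. split; [|split; [|split]].
  - induction j as [|j IH]; [apply H1|]. apply clopen_or; [exact IH|apply H1].
  - intros i j y Hij Hi. induction Hij as [|j Hij IH]; [exact Hi|left; exact IH].
  - intros Hy. apply H2 in Hy as [j Hj]. exists j. destruct j; [exact Hj|right; exact Hj].
  - intros [j Hj]. apply H2. induction j as [|j IH]; [eauto|].
    destruct Hj as [Hj|Hj]; eauto.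
Qed.

Section Counter.
Context (D : nat -> nat -> Y -> Prop).
Context (HD : forall k j, clopen (D k j)).

(* The counter waits at [k] until the clopen exhaustion [D k] of the complement
   of the k-th closed set reaches the point; [signal] marks the increments. *)
Fixpoint counter (y : Y) (s : nat) : nat :=
  match s with
  | 0 => 0
  | S s' => if excluded_middle_informative (D (counter y s') s' y)
            then S (counter y s') else counter y s'
  end.

Definition signal (y : Y) (s : nat) : bool :=
  if excluded_middle_informative (D (counter y s) s y) then true else false.

Lemma counter_S y s : counter y (S s) = if signal y s then S (counter y s) else counter y s.
Proof. unfold signal; cbn. destruct (excluded_middle_informative _); reflexivity. Qed.

Lemma signalP y s : signal y s = true <-> D (counter y s) s y.
Proof.
  unfold signal. destruct (excluded_middle_informative _); intuition discriminate.
Qed.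

(** Each of the first s decisions is membership in a clopen set, so it is constant near y. *)
Lemma signal_local s y : exists eps, 0 < eps /\ forall z, d y z < eps ->
  counter z s = counter y s /\ forall j, (j < s)%nat -> signal z j = signal y j.
Proof.
  induction s as [|s [e [He IH]]].
  - exists 1. split; [lra|]. intros z _. split; [reflexivity|]. intros; lia.
  - assert (H : exists e', 0 < e' /\ forall z, d y z < e' ->
      (D (counter y s) s z <-> D (counter y s) s y)).
    { destruct (HD (counter y s) s) as [Ho Hc].
      destruct (classic (D (counter y s) s y)) as [Hy|Hy];
        [destruct (Ho y Hy) as [e' [E' H']]|destruct (Hc y Hy) as [e' [E' H']]];
        exists e'; split; auto; intros z Hz; specialize (H' z Hz); tauto. }
    destruct H as [e' [He' H']].
    exists (Rmin e e'). split; [apply Rmin_pos; assumption|].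
    intros z Hz. pose proof (Rmin_l e e'). pose proof (Rmin_r e e').
    destruct (IH z) as [C1 C2]; [lra|]. specialize (H' z ltac:(lra)).
    assert (E : signal z s = signal y s).
    { apply eq_true_iff_eq. rewrite !signalP, C1. exact H'. }
    split; [rewrite !counter_S, C1, E; reflexivity|].
    intros j Hj. destruct (Nat.eq_dec j s) as [->|]; [exact E|apply C2; lia].
Qed.

(** The counter cannot leave k, since this would put y into some [D k s]. *)
Lemma counter_le y k : (forall j, ~ D k j y) -> forall s, (counter y s <= k)%nat.
Proof.
  intros H s. induction s as [|s IH]; [cbn; lia|]. rewrite counter_S.
  destruct (signal y s) eqn:E; [|exact IH]. apply signalP in E.
  assert (counter y s <> k) by (intros E'; rewrite E' in E; apply (H s), E). lia.
Qed.

Lemma signal_finite y k : (forall j, ~ D k j y) ->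
  exists m, forall j, (m <= j)%nat -> signal y j = false.
Proof.
  intros H. apply NNPP. intros Hn.
  assert (Hi : forall m, exists j, (m <= j)%nat /\ signal y j = true).
  { intros m. apply NNPP. intros Hm. apply Hn. exists m. intros j Hj.
    apply not_true_iff_false. intros E. apply Hm; eauto. }
  assert (Hmono : forall i j, (i <= j)%nat -> (counter y i <= counter y j)%nat).
  { intros i j Hij. induction Hij as [|j Hij IH]; [lia|].
    rewrite counter_S. destruct (signal y j); lia. }
  assert (Hu : forall q, exists s, (q <= counter y s)%nat).
  { induction q as [|q [s Hs]]; [exists 0%nat; lia|].
    destruct (Hi s) as [j [Hj E]]. exists (S j). rewrite counter_S, E.
    specialize (Hmono s j Hj). lia. }
  destruct (Hu (S k)) as [s Hs]. pose proof (counter_le y k H s). lia.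
Qed.

(** After a last signal the counter would stay at a fixed k, but the increasing sets [D k]
    eventually contain y and force another signal. *)
Lemma signal_infinite y : (forall k i j, (i <= j)%nat -> D k i y -> D k j y) ->
  (forall k, exists j, D k j y) -> forall m, exists j, (m <= j)%nat /\ signal y j = true.
Proof.
  intros Hinc Hex m. apply NNPP. intros Hn.
  assert (Hc : forall i, counter y (m + i) = counter y m).
  { induction i as [|i IH]; [rewrite Nat.add_0_r; reflexivity|].
    rewrite Nat.add_succ_r, counter_S, IH.
    destruct (signal y (m + i)) eqn:E; [|reflexivity].
    exfalso; apply Hn. exists (m + i)%nat. split; [lia|exact E]. }
  destruct (Hex (counter y m)) as [j Hj]. apply Hn. exists (m + j)%nat. split; [lia|].
  apply signalP. rewrite Hc. apply Hinc with j; [lia|exact Hj].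
Qed.

End Counter.

Lemma Sigma02_signal B : Sigma02 d B -> exists om : Y -> nat -> bool,
  (forall s y, exists eps, 0 < eps /\
     forall z, d y z < eps -> forall j, (j < s)%nat -> om z j = om y j) /\
  (forall y, B y -> exists m, forall j, (m <= j)%nat -> om y j = false) /\
  (forall y, ~ B y -> forall m, exists j, (m <= j)%nat /\ om y j = true).
Proof.
  intros [C [HC HB]].
  destruct (function_choice _ (fun k => open_clopen_exhaustion _ (HC k))) as [D HD].
  exists (signal D). split; [|split].
  - intros s y. destruct (signal_local D (fun k => proj1 (HD k)) s y) as [e [He H]].
    exists e. split; [exact He|]. intros z Hz. apply H, Hz.
  - intros y Hy. apply HB in Hy as [k Hk]. apply (signal_finite D y k).
    intros j Hj. apply (proj2 (proj2 (HD k)) y); eauto.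
  - intros y Hy. apply signal_infinite.
    + intros k i j. apply (HD k).
    + intros k. apply (HD k). intros Hk. apply Hy, HB. eauto.
Qed.

End ZeroDim.

(** * Continuity of the reduction and completeness *)

Lemma kernel_limit_local n om l : exists s, forall om',
  (forall j, (j < s)%nat -> om' j = om j) ->
  forall g, In g l -> kernel (limit_set om') n g = kernel (limit_set om) n g.
Proof.
  exists (list_max (map (fun g : F n => length (proj1_sig g)) l)). intros om' H g Hg.
  assert (Hl : (length (proj1_sig g) <= list_max (map (fun g : F n => length (proj1_sig g)) l))%nat).
  { pose proof (proj1 (list_max_le (map (fun g : F n => length (proj1_sig g)) l) _) (le_n _)) as Hm.
    rewrite Forall_forall in Hm. apply Hm, in_map_iff; eauto. }
  unfold kernel.
  assert (E : forall y, limit_set om' (trace y (proj1_sig g)) = limit_set om (trace y (proj1_sig g))).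
  { intros y. apply limit_set_local. intros j Hj. apply H.
    pose proof (length_trace y (proj1_sig g)). lia. }
  cbn [forallb]. rewrite !E. reflexivity.
Qed.

Theorem mainTheorem3 (n : nat) (Hn : (1 < n)%nat) :
  Sigma02_complete_Gn (ExpGrowthSet (n := n)).
Proof.
  split; [apply Sigma02_ExpGrowthSet|].
  intros Y d Hd _ Hsep Hzd B HB.
  destruct (Sigma02_signal d Hd Hsep Hzd B HB) as [om [Hloc [Hfin Hinf]]].
  exists (fun y => kernel (limit_set (om y)) n). split; [split|].
  - intros y. apply kernel_normal, normal_set_limit.
  (* Membership in U is secured by finitely many coordinates of the kernel, these by finitely many
     terms of the sequence, and these by a ball about y. *)
  - intros U HU y Hy. destruct (HU _ Hy) as [l Hl].
    destruct (kernel_limit_local n (om y) l) as [s Hs].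
    destruct (Hloc s y) as [eps [He H]]. exists eps. split; [exact He|].
    intros z Hz. apply Hl, Hs, H, Hz.
  - intros y. split.
    + intros [_ Hg]. apply NNPP. intros Hy. revert Hg.
      apply not_exp_growth_kernel; [apply normal_set_limit|]. intros s Hs.
      (* Infinitely many contractions make the exponent (5/6)^j smaller than any given s. *)
      destruct (pow_lt_1_zero (5 / 6) ltac:(rewrite Rabs_pos_eq; lra) s Hs) as [j Hj].
      apply (summable_mono _ ((5 / 6) ^ j)).
      * specialize (Hj j (le_n _)). pose proof (Rle_abs ((5 / 6) ^ j)). lra.
      * apply summable_limit, Hinf, Hy.
    + intros Hy. split; [apply kernel_normal, normal_set_limit|].
      destruct (Hfin y Hy) as [m Hm]. destruct (exp_family_limit m _ Hm) as [C HC].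
      apply (exp_growth_kernel _ n C Hn); [apply normal_set_limit|exact HC].
Qed.
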